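(* Let $A,A_0:\mathbb{R}\to M_n(\mathbb{R})$ and $f:\mathbb{R}\times\mathbb{R}^n\times\mathbb{R}^n\to\mathbb{R}^n$ be continuous, and let $M,M_0,\mu,\ell_1,\ell_2>0$ be constants such that, for all $t\in\mathbb{R}$ and $x,x',y,y'\in\mathbb{R}^n$, $\|A(t)\|\le M$, $\|A_0(t)\|\le M_0$, $|f(t,x,y)|\le\mu$ and $|f(t,x,y)-f(t,x',y')|\le \ell_1|x-x'|+\ell_2|y-y'|$. Let $\gamma$ be the piecewise constant argument associated with sequences $\{t_i\}$, $\{\zeta_i\}$ and constant $\theta>0$ as in the context, and assume there are $\nu^+,\nu^->0$ with $$\sup_{k\in\mathbb{Z}}\rho_k^+(A)\ln\rho_k^+(A_0)\le\nu^+<1,\qquad \sup_{k\in\mathbb{Z}}\rho_k^-(A)\ln\rho_k^-(A_0)\le\nu^-<1 .$$ Suppose that the linear system $\dot y(t)=A(t)y(t)+A_0(t)y(\gamma(t))$ has an $\alpha$-exponential dichotomy on $(-\infty,\infty)$ with projection $P$ and constants $K\ge1$, $\alpha>0$, and that for every integer $k$ the series $$\sum_{r=-\infty}^{k}PZ(0,t_r)\int_{t_r}^{\zeta_r}\Phi(t_r,s)\,ds,\qquad \sum_{r=-\infty}^{k}PZ(0,t_{r+1})\int_{\zeta_r}^{t_{r+1}}\Phi(t_{r+1},s)\,ds,$$ $$\sum_{r=k}^{+\infty}(I-P)Z(0,t_r)\int_{t_r}^{\zeta_r}\Phi(t_r,s)\,ds,\qquad \sum_{r=k}^{+\infty}(I-P)Z(0,t_{r+1})\int_{\zeta_r}^{t_{r+1}}\Phi(t_{r+1},s)\,ds$$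 are absolutely convergent. Assume moreover $$2(\ell_1+\ell_2)K\rho^*<\alpha,$$ $$F_1(\theta)(M_0+\ell_2)\theta=v<1,\quad F_1(\theta)=\frac{e^{(M+\ell_1)\theta}-1}{(M+\ell_1)\theta},$$ $$F_0(\theta)M_0\theta=\tilde v<1,\quad F_0(\theta)=\frac{e^{M\theta}-1}{M\theta}.$$ Then the systems $\dot y(t)=A(t)y(t)+A_0(t)y(\gamma(t))$ and $\dot x(t)=A(t)x(t)+A_0(t)x(\gamma(t))+f(t,x(t),x(\gamma(t)))$ are strongly topologically equivalent.
   Context: $|\cdot|$ is a norm on $\mathbb{R}^n$ and $\|\cdot\|$ the induced matrix norm. Argument $\gamma$: $\{t_i\}_{i\in\mathbb{Z}}$, $\{\zeta_i\}_{i\in\mathbb{Z}}$ are real sequences with $t_i<t_{i+1}$ and $t_i\le\zeta_i\le t_{i+1}$ for all $i$, $t_i\to\pm\infty$ as $i\to\pm\infty$, $t_{i+1}-t_i\le\theta$ for all $i$, and $\gamma(t)=\zeta_i$ for $t\in[t_i,t_{i+1})$. Solutions: a continuous function $u$ is a solution of such a differential equation if $u'(t)$ exists for every $t\in\mathbb{R}$, except possibly at the points $t_i$, where one-sided derivatives exist, the equation holds on each $(t_i,t_{i+1})$, and it holds for the right derivative at each $t_i$. Notation: $\Phi(t)$ is the fundamental matrix of $x'=A(t)x$ with $\Phi(0)=I$, $\Phi(t,s)=\Phi(t)\Phi^{-1}(s)$. For a matrix function $Q$, $\rho_k^+(Q)=\exp\big(\int_{t_k}^{\zeta_k}\|Q(s)\|ds\big)$,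 $\rho_k^-(Q)=\exp\big(\int_{\zeta_k}^{t_{k+1}}\|Q(s)\|ds\big)$; $\rho(A)=\sup_{k}\rho_k^+(A)\rho_k^-(A)$ (finite) and $\rho^*=\rho(A)e^{\alpha\theta}$. $Z(t,\tau)$ is the transition matrix of the linear system: $t\mapsto Z(t,\tau)\xi$ is its unique solution on $\mathbb{R}$ with value $\xi$ at $t=\tau$ (well defined and invertible under the condition on $\rho_k^\pm$). $\alpha$-exponential dichotomy: there is a projection $P$ ($P^2=P$) and constants $K\ge1$, $\alpha>0$ with $\|Z_p(t,s)\|\le Ke^{-\alpha|t-s|}$ for all $t,s$, where $Z_p(t,s)=Z(t,0)PZ(0,s)$ if $t\ge s$ and $Z_p(t,s)=-Z(t,0)(I-P)Z(0,s)$ if $s>t$. Topological equivalence (of the linear and the nonlinear system): there exists $H:\mathbb{R}\times\mathbb{R}^n\to\mathbb{R}^n$ such that (i) for each fixed $t$, $u\mapsto H(t,u)$ is a homeomorphism of $\mathbb{R}^n$; (ii) $H(t,u)-u$ is bounded on $\mathbb{R}\times\mathbb{R}^n$; (iii) if $x(t)$ is a solution of the nonlinear system then $H(t,x(t))$ is a solution of the linear system; and the function $L(t,u)=H^{-1}(t,u)$ (inverse of $H(t,\cdot)$ at $u$) also has properties (i)–(iii), with the roles of the two systems in (iii) exchanged. Strong topological equivalence: in addition $H$ and $L$ are uniformly continuous for all $t$, i.e. for all $t$ the maps $u\mapsto H(t,u)$ and $u\mapsto L(t,u)$ are uniformly continuous. *)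

(* Defs.v *)
From HB Require Import structures.
From mathcomp Require Export all_boot all_order all_algebra.
From mathcomp Require Export all_classical all_reals all_analysis.
Export Order.TTheory GRing.Theory Num.Theory.
Export numFieldNormedType.Exports.

Set Implicit Arguments.
Unset Strict Implicit.
Unset Printing Implicit Defensive.

Local Open Scope classical_set_scope.
Local Open Scope ring_scope.

(* [N] is an arbitrary norm on R^n.  Continuity, derivatives and uniform
   continuity below refer to the canonical (max-norm) structures on
   ['cV[R]_n] and ['M[R]_n]; all norms being equivalent in finite dimension,
   these are the structures induced by [N]. *)
Definition is_norm (R : realType) (n : nat) (N : 'cV[R]_n -> R) : Prop :=
  [/\ forall x, N x = 0 -> x = 0,
      forall a x, N (a *: x) = `|a| * N x
    & forall x y, N (x + y) <= N x + N y].

Definition opnorm (R : realType) (n : nat) (N : 'cV[R]_n -> R)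
    (Q : 'M[R]_n) : R :=
  sup [set N (Q *m x) | x in [set x : 'cV[R]_n | N x <= 1]].

Definition pca_seqs (R : realType) (t_ zeta : int -> R) (theta : R) : Prop :=
  [/\ forall i, t_ i < t_ (i + 1),
      forall i, t_ i <= zeta i <= t_ (i + 1),
      t_ k%:Z @[k --> \oo] --> +oo /\ t_ (- k%:Z) @[k --> \oo] --> -oo
    & forall i, t_ (i + 1) - t_ i <= theta].

Definition pca_arg (R : realType) (t_ zeta : int -> R) (gamma : R -> R) : Prop :=
  forall i t, t_ i <= t < t_ (i + 1) -> gamma t = zeta i.

(* [u] solves u'(t) = g t (u t) (u (gamma t)).  Since the intervals
   [t_i, t_(i+1)) cover R, the second clause gives the two-sided derivative at
   every t other than the t_i; at t_i only one-sided derivatives are required,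
   and the equation holds for the right one. *)
Definition is_solution (R : realType) (n : nat) (t_ : int -> R)
    (gamma : R -> R) (g : R -> 'cV[R]_n -> 'cV[R]_n -> 'cV[R]_n)
    (u : R -> 'cV[R]_n) : Prop :=
  [/\ continuous u,
      forall i t, t_ i < t < t_ (i + 1) ->
        is_derive t (1 : R) u (g t (u t) (u (gamma t))),
      forall i, h^-1 *: (u (h + t_ i) - u (t_ i)) @[h --> 0^'+] -->
        g (t_ i) (u (t_ i)) (u (gamma (t_ i)))
    & forall i, cvg (h^-1 *: (u (h + t_ i) - u (t_ i)) @[h --> 0^'-])].

Definition lin_rhs (R : realType) (n : nat) (A A0 : R -> 'M[R]_n)
    (t : R) (x y : 'cV[R]_n) : 'cV[R]_n :=
  A t *m x + A0 t *m y.

Definition nonlin_rhs (R : realType) (n : nat) (A A0 : R -> 'M[R]_n)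
    (f : R -> 'cV[R]_n -> 'cV[R]_n -> 'cV[R]_n)
    (t : R) (x y : 'cV[R]_n) : 'cV[R]_n :=
  A t *m x + A0 t *m y + f t x y.

Definition is_fundamental (R : realType) (n : nat) (A : R -> 'M[R]_n)
    (X : R -> 'M[R]_n) : Prop :=
  X 0 = 1%:M /\ forall t, is_derive t (1 : R) X (A t *m X t).

(* Definite description: for continuous [A] there is exactly one such X. *)
Definition fundamental (R : realType) (n : nat) (A : R -> 'M[R]_n) :
    R -> 'M[R]_n :=
  get (is_fundamental A).

Definition Phi (R : realType) (n : nat) (A : R -> 'M[R]_n) (t s : R) : 'M[R]_n :=
  fundamental A t *m invmx (fundamental A s).

Definition is_transition (R : realType) (n : nat) (t_ : int -> R)
    (gamma : R -> R) (A A0 : R -> 'M[R]_n) (Z : R -> R -> 'M[R]_n) : Prop :=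
  forall tau (xi : 'cV[R]_n),
    [/\ is_solution t_ gamma (lin_rhs A A0) (fun t => Z t tau *m xi),
        Z tau tau *m xi = xi
      & forall u, is_solution t_ gamma (lin_rhs A A0) u -> u tau = xi ->
          forall t, u t = Z t tau *m xi].

(* Definite description: [is_transition] determines Z uniquely, and such a Z
   exists when rho_k^+(A) ln rho_k^+(A0) and rho_k^-(A) ln rho_k^-(A0) are
   bounded by constants smaller than 1. *)
Definition transition (R : realType) (n : nat) (t_ : int -> R)
    (gamma : R -> R) (A A0 : R -> 'M[R]_n) : R -> R -> 'M[R]_n :=
  get (is_transition t_ gamma A A0).

Definition rho_plus (R : realType) (n : nat) (N : 'cV[R]_n -> R)
    (t_ zeta : int -> R) (Q : R -> 'M[R]_n) (k : int) : R :=
  expR (\int[lebesgue_measure]_(s in `[t_ k, zeta k]) opnorm N (Q s)).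

Definition rho_minus (R : realType) (n : nat) (N : 'cV[R]_n -> R)
    (t_ zeta : int -> R) (Q : R -> 'M[R]_n) (k : int) : R :=
  expR (\int[lebesgue_measure]_(s in `[zeta k, t_ (k + 1)]) opnorm N (Q s)).

Definition rho (R : realType) (n : nat) (N : 'cV[R]_n -> R)
    (t_ zeta : int -> R) (Q : R -> 'M[R]_n) : R :=
  sup (range (fun k => rho_plus N t_ zeta Q k * rho_minus N t_ zeta Q k)).

Definition green (R : realType) (n : nat) (Z : R -> R -> 'M[R]_n)
    (P : 'M[R]_n) (t s : R) : 'M[R]_n :=
  if s <= t then Z t 0 *m P *m Z 0 s
  else - (Z t 0 *m (1%:M - P) *m Z 0 s).

Definition exp_dichotomy (R : realType) (n : nat) (N : 'cV[R]_n -> R)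
    (Z : R -> R -> 'M[R]_n) (P : 'M[R]_n) (K alpha : R) : Prop :=
  [/\ P *m P = P, 1 <= K, 0 < alpha
    & forall t s, opnorm N (green Z P t s) <= K * expR (- alpha * `|t - s|)].

Definition mx_integral (R : realType) (n : nat) (a b : R)
    (Q : R -> 'M[R]_n) : 'M[R]_n :=
  \matrix_(i, j) \int[lebesgue_measure]_(s in `[a, b]) Q s i j.

Definition abs_convergent (R : realType) (n : nat) (N : 'cV[R]_n -> R)
    (D : set int) (T : int -> 'M[R]_n) : Prop :=
  summable D (fun r => (opnorm N (T r))%:E).

(* Q stands for P or for I - P. *)
Definition series_plus (R : realType) (n : nat) (t_ zeta : int -> R)
    (A : R -> 'M[R]_n) (Z : R -> R -> 'M[R]_n) (Q : 'M[R]_n) (r : int) :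
    'M[R]_n :=
  Q *m Z 0 (t_ r) *m mx_integral (t_ r) (zeta r) (Phi A (t_ r)).

Definition series_minus (R : realType) (n : nat) (t_ zeta : int -> R)
    (A : R -> 'M[R]_n) (Z : R -> R -> 'M[R]_n) (Q : 'M[R]_n) (r : int) :
    'M[R]_n :=
  Q *m Z 0 (t_ (r + 1)) *m
    mx_integral (zeta r) (t_ (r + 1)) (Phi A (t_ (r + 1))).

Definition equiv_map (R : realType) (n : nat) (N : 'cV[R]_n -> R)
    (S1 S2 : set (R -> 'cV[R]_n)) (H : R -> 'cV[R]_n -> 'cV[R]_n) : Prop :=
  [/\ forall t, continuous (H t) /\
        exists G : 'cV[R]_n -> 'cV[R]_n,
          [/\ continuous G, cancel (H t) G & cancel G (H t)],
      exists C : R, forall t u, N (H t u - u) <= C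
    & forall x, S1 x -> S2 (fun t => H t (x t))].

Definition strongly_top_equivalent (R : realType) (n : nat)
    (N : 'cV[R]_n -> R) (lin nonlin : set (R -> 'cV[R]_n)) : Prop :=
  exists H L : R -> 'cV[R]_n -> 'cV[R]_n,
    [/\ forall t, cancel (H t) (L t) /\ cancel (L t) (H t),
        equiv_map N nonlin lin H,
        equiv_map N lin nonlin L
      & forall t, unif_continuous (H t) /\ unif_continuous (L t)].

(* Main.v *)
Require Import Defs.
From mathcomp Require Import ring lra zify.

Set Implicit Arguments.
Unset Strict Implicit.
Unset Printing Implicit Defensive.

Local Open Scope classical_set_scope.
Local Open Scope ring_scope.

(** A solution [x] of the perturbed equation is matched with the unique solution
    [y] of the linear one such that [x - y] is bounded: [y = x + z], where [z] is
    the bounded solution of the linear equation forced by [- f(t, x, x(gamma))],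
    and conversely [x = y + z] for a fixed point [z] of a contraction.  [H t u]
    and [L t u] evaluate at time [t] the partner of the solution through [(t, u)].

    On the cell [[t_k, t_(k+1)]] let [c_k' = A c_k + v], [c_k(zeta_k) = 0]; since
    [c_k] vanishes at [zeta_k], it also solves the forced equation with deviated
    argument.  The bounded solution is [c_k(t) + sum_r Zp(t, t_r) j_r], where
    [j_r = c_(r-1)(t_r) - c_r(t_r)] has norm at most
    [rho(A) |v| (zeta_r - zeta_(r-1))].  With [m_r = zeta_r - zeta_(r-1)],
    [|t - zeta_k| + sum_r exp(- alpha |t - t_r|) m_r <= 2 exp(alpha theta) / alpha],
    where the factor [exp(alpha theta)] leaves just enough room for the local term
    [|t - zeta_k|] coming from [c_k(t)]; hence the solution operator has norm at
    most [2 K rho* / alpha].  The same estimate for the weight [exp(beta |t - tau|)]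
    with small [beta] gives the uniform continuity of [H tau] and [L tau]. *)

(** * Norms on column vectors *)

(** The smallness hypothesis fixes the constant: the solution operator must be bounded by exactly 2
    K rho* / alpha. The crude estimate d <= exp(alpha theta) (1 - exp(- alpha d)) / alpha would
    spend the whole factor exp(alpha theta) on the sum over the nodes. The inequality 2 sinh x >= 2
    x loses only exp(alpha theta / 2), and the other half pays for the local term.

    Since c_k vanishes at zeta_k, the coefficient [A0] drops out of its equation: the jumps are
    controlled by rho(A) alone, and [A0] acts only through Z.

    Uniform continuity at a fixed tau is the delicate point. Two solutions close at tau may separate
    exponentially, so the difference of their forcings is small only on a bounded window; elsewhere
    nothing better than 2 mu is known. The exponential weight absorbs this bound far from tau, at
    the price of replacing alpha by alpha - beta, and the strict inequality in the hypothesis leaves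
    room for a small beta. Uniqueness of the partner is the case of distance 0 at tau. *)

Lemma lipschitz_continuous (R : realType) (U W : normedModType R) (f : U -> W) (C : R) :
  0 < C -> (forall x y, `|f x - f y| <= C * `|x - y|) -> continuous f.
Proof.
move=> C0 hC x; apply/cvgrPdist_lt => e e0.
apply/nbhs_ballP; exists (e / C) => /=; first exact: divr_gt0.
move=> y; rewrite -ball_normE/= => xy.
by rewrite (le_lt_trans (hC _ _))// mulrC -ltr_pdivlMr.
Qed.

Section norm.
Variables (R : realType) (n : nat) (N : 'cV[R]_n -> R).
Hypothesis hN : is_norm N.

Lemma norm0 : N 0 = 0.
Proof. by have [_ h _] := hN; rewrite -(scale0r 0) h normr0 mul0r. Qed.

Lemma normZ a x : N (a *: x) = `|a| * N x.
Proof. by have [_ h _] := hN. Qed.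

Lemma normD x y : N (x + y) <= N x + N y.
Proof. by have [_ _ h] := hN. Qed.

Lemma normN x : N (- x) = N x.
Proof. by rewrite -scaleN1r normZ normrN1 mul1r. Qed.

Lemma norm_ge0 x : 0 <= N x.
Proof.
have := normD x (- x); rewrite subrr norm0 normN => h.
by rewrite -(pmulr_rge0 _ (ltr0n R 2)) mulr_natl mulr2n.
Qed.

Lemma norm_eq0 x : N x = 0 -> x = 0.
Proof. by have [h _ _] := hN; apply: h. Qed.

Lemma normB x y : N (x - y) <= N x + N y.
Proof. by rewrite -(normN y); exact: normD. Qed.

Lemma norm_sub x y : N x <= N y + N (x - y).
Proof. by rewrite -{1}(subrK y x) addrC; exact: normD. Qed.

Lemma norm_distC x y : N (x - y) = N (y - x).
Proof. by rewrite -normN opprB. Qed.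

Lemma norm_sum (I : Type) (r : seq I) (F : I -> 'cV[R]_n) :
  N (\sum_(i <- r) F i) <= \sum_(i <- r) N (F i).
Proof.
elim/big_ind2 : _ => [|x a y b hx hy|//]; first by rewrite norm0.
by apply: (le_trans (normD _ _)); exact: lerD.
Qed.

Lemma entry_le_norm m p (Q : 'M[R]_(m, p)) i j : `|Q i j| <= `|Q|.
Proof.
rewrite [leRHS]/Num.Def.normr/= mx_normrE.
by apply: le_trans; last exact: (le_bigmax _ _ (i, j)).
Qed.

Lemma norm_le_entries m p (Q : 'M[R]_(m, p)) e : 0 <= e ->
  (forall i j, `|Q i j| <= e) -> `|Q| <= e.
Proof.
move=> e0 h; rewrite [leLHS]/Num.Def.normr/= mx_normrE.
by apply: bigmax_le => // -[i j] _; exact: h.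
Qed.

Lemma norm_mulmx (Q : 'M[R]_n) (x : 'cV[R]_n) : `|Q *m x| <= n%:R * `|Q| * `|x|.
Proof.
apply: norm_le_entries => [|i j]; first by rewrite !mulr_ge0.
rewrite mxE (le_trans (ler_norm_sum _ _ _))//.
rewrite (@le_trans _ _ (\sum_(k < n) `|Q| * `|x|))//; last first.
  by rewrite sumr_const card_ord -mulrA mulr_natl.
by apply: ler_sum => k _; rewrite normrM ler_pM// entry_le_norm.
Qed.

Lemma norm_le_sup : exists2 C, 0 < C & forall x, N x <= C * `|x|.
Proof.
exists (1 + \sum_i N (delta_mx i 0)) => [|x].
  by rewrite ltr_pwDl// sumr_ge0// => i _; exact: norm_ge0.
rewrite {1}(matrix_sum_delta x); under eq_bigr do rewrite big_ord1.
rewrite (le_trans (norm_sum _ _))// mulrDl mul1r ler_wpDl//.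
rewrite mulr_suml ler_sum// => i _; rewrite normZ mulrC ler_wpM2l ?norm_ge0//.
exact: entry_le_norm.
Qed.

Lemma is_norm_lipschitz : exists2 C, 0 < C & forall x y, `|N x - N y| <= C * `|x - y|.
Proof.
have [C C0 hC] := norm_le_sup; exists C => // x y.
apply: le_trans (hC _); rewrite ler_norml; apply/andP; split.
  by rewrite lerNl opprB lerBlDl norm_distC norm_sub.
by rewrite lerBlDl norm_sub.
Qed.

Lemma is_norm_continuous : continuous N.
Proof.
have [C C0 hC] := is_norm_lipschitz; exact: (lipschitz_continuous C0 hC).
Qed.

(** Equivalence of norms: [N] is continuous and positive on the compact unit sphere of the max norm,
    and c is the inverse of its minimum there. Columns are transposed because [EVT_min_rV] concerns
    row vectors. *)
Lemma norm_ge_sup : exists2 c, 0 < c & forall x, `|x| <= c * N x.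
Proof.
pose S : set 'rV[R]_n := [set v | `|v| = 1].
have nT (v : 'cV[R]_n) : `|v^T| = `|v|.
  apply/eqP; rewrite eq_le; apply/andP; split; apply: norm_le_entries => // i j.
    by rewrite mxE; exact: entry_le_norm.
  by have := entry_le_norm v^T j i; rewrite mxE.
have nT' (v : 'rV[R]_n) : `|v^T| = `|v| by rewrite -nT trmxK.
have cS : compact S.
  apply: bounded_closed_compact.
    by exists 1; split=> // M M1 v /= ->; exact: ltW.
  have -> : S = (fun v : 'rV[R]_n => `|v|) @^-1` [set 1] by [].
  apply: closed_comp => [v _|]; first exact: norm_continuous.
  exact: closed_eq.
have cT : continuous (fun v : 'rV[R]_n => N v^T).
  have [C C0 hC] := is_norm_lipschitz; apply: (lipschitz_continuous C0) => x y.
  by rewrite -nT' linearB/= hC.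
(* If the sphere is empty, every vector is zero (dimension 0) and any constant serves. *)
have [S0|S0] := pselect (S !=set0); last first.
  exists 1 => // x; rewrite mul1r; have [->|x0] := eqVneq x 0.
    by rewrite normr0 norm_ge0.
  exfalso; apply: S0; exists (`|x|^-1 *: x^T).
  by rewrite /S/= normrZ nT normfV normr_id mulVf// normr_eq0.
have [v Sv hv] := @EVT_min_rV R n (fun v => N v^T) S S0 cS (continuous_subspaceT cT).
have v0 : 0 < N v^T.
  rewrite lt_neqAle norm_ge0 andbT eq_sym; apply/eqP => /norm_eq0 /eqP.
  rewrite trmx_eq0 => /eqP ve; move: Sv; rewrite inE /S/= ve normr0 => /esym/eqP.
  by rewrite oner_eq0.
exists (N v^T)^-1; first by rewrite invr_gt0.
move=> x; have [->|x0] := eqVneq x 0; first by rewrite normr0 norm0 mulr0.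
have nx0 : 0 < `|x| by rewrite normr_gt0.
have := hv (`|x|^-1 *: x^T); rewrite inE /S/= normrZ nT normfV normr_id.
rewrite mulVf ?gt_eqF// => /(_ erefl).
rewrite linearZ/= trmxK normZ normfV normr_id.
by rewrite ler_pdivlMl// => h; rewrite ler_pdivlMl// mulrC.
Qed.

(** [sup] dominates the elements of a set only if the set is bounded; the bound comes from the
    equivalence of [N] with the max norm. *)
Lemma opnorm_bounded (Q : 'M[R]_n) :
  has_ubound [set N (Q *m x) | x in [set x : 'cV[R]_n | N x <= 1]].
Proof.
have [C C0 hC] := norm_le_sup; have [c c0 hc] := norm_ge_sup.
exists (C * (n%:R * `|Q| * c)) => _ [x /= x1 <-].
rewrite (le_trans (hC _))// ler_wpM2l ?(ltW C0)// (le_trans (norm_mulmx _ _))//.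
rewrite ler_wpM2l ?mulr_ge0// (le_trans (hc _))//.
by rewrite -[leRHS]mulr1 ler_wpM2l// ltW.
Qed.

Lemma opnorm_ge0 (Q : 'M[R]_n) : 0 <= opnorm N Q.
Proof.
apply: (ub_le_sup (opnorm_bounded Q)); exists 0; last by rewrite mulmx0 norm0.
by rewrite /= norm0 ler01.
Qed.

Lemma le_opnorm (Q : 'M[R]_n) x : N (Q *m x) <= opnorm N Q * N x.
Proof.
have [->|x0] := eqVneq x 0; first by rewrite mulmx0 norm0 mulr0.
have Nx : 0 < N x.
  rewrite lt_neqAle norm_ge0 andbT eq_sym.
  by apply: contraNneq x0 => /norm_eq0 ->.
have : N (Q *m ((N x)^-1 *: x)) <= opnorm N Q.
  apply: (ub_le_sup (opnorm_bounded Q)); exists ((N x)^-1 *: x) => //=.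
  by rewrite normZ gtr0_norm ?invr_gt0// mulVf// gt_eqF.
by rewrite -scalemxAr normZ gtr0_norm ?invr_gt0// ler_pdivrMl// mulrC.
Qed.

Lemma opnorm_le (Q : 'M[R]_n) c : 0 <= c ->
  (forall x, N (Q *m x) <= c * N x) -> opnorm N Q <= c.
Proof.
move=> c0 h; apply: ge_sup; first by exists (N (Q *m 0)), 0 => //=; rewrite norm0.
by move=> _ [x /= x1 <-]; rewrite (le_trans (h x))// -[leRHS]mulr1 ler_wpM2l.
Qed.

Lemma opnorm_lipschitz :
  exists2 C, 0 < C & forall Q Q', `|opnorm N Q - opnorm N Q'| <= C * `|Q - Q'|.
Proof.
have [C C0 hC] := norm_le_sup; have [c c0 hc] := norm_ge_sup.
(* [n.+1] instead of [n] keeps the Lipschitz constant positive in dimension 0. *)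
have le Q : opnorm N Q <= C * ((n.+1)%:R * c) * `|Q|.
  apply: opnorm_le => [|x]; first by rewrite !mulr_ge0// ltW.
  rewrite (le_trans (hC _))// -!mulrA ler_wpM2l ?(ltW C0)//.
  rewrite (le_trans (norm_mulmx _ _))// -!mulrA ler_pM ?mulr_ge0//.
    by rewrite ler_nat.
  by rewrite [leRHS]mulrCA ler_wpM2l.
have tri Q Q' : opnorm N Q <= opnorm N Q' + opnorm N (Q - Q').
  apply: opnorm_le => [|x]; first by rewrite addr_ge0 ?opnorm_ge0.
  rewrite -{1}(subrK Q' Q) addrC mulmxDl (le_trans (normD _ _))// mulrDl.
  by rewrite lerD// le_opnorm.
exists (C * (n.+1%:R * c)); first by rewrite !mulr_gt0.
move=> Q Q'; rewrite ler_norml; apply/andP; split.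
  by rewrite lerNl opprB lerBlDl (le_trans (tri Q' Q))// lerD2l distrC le.
by rewrite lerBlDl (le_trans (tri Q Q'))// lerD2l le.
Qed.

Lemma opnorm_continuous : continuous (opnorm N).
Proof. by have [C C0 hC] := opnorm_lipschitz; exact: lipschitz_continuous hC. Qed.

End norm.

(** * Comparison of vector-valued functions *)

Section derivative.
Variables (R : realType) (W : normedModType R).
Implicit Types (u : R -> W) (d : W).

Lemma is_derive_cvgP u t d : is_derive t (1 : R) u d <->
  h^-1 *: (u (h + t) - u t) @[h --> 0^'] --> d.
Proof.
have e : (fun h : R => h^-1 *: (u (h *: (1 : R) + t) - u t)) =
         (fun h => h^-1 *: (u (h + t) - u t)).
  by apply/funext => h; rewrite [h *: _]mulr1.
split=> [ud|ud].
  have [+ <-] := ud; rewrite /derivable /derive e; exact.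
apply: DeriveDef; first by apply/cvg_ex; exists d; rewrite e.
by rewrite /derive e; apply: cvg_lim.
Qed.

Lemma is_derive_continuous u t d : is_derive t (1 : R) u d -> {for t, continuous u}.
Proof.
by case=> du _; apply: differentiable_continuous; apply/derivable1_diffP.
Qed.

End derivative.

Section derivative_reflect.
Variables (R : realType) (W : normedModType R).
Implicit Types (u : R -> W) (d : W).

(** Affine change of time. With s = 1 or s = -1, one estimate on r >= 0 serves both sides of
    [tau]. *)
Lemma is_derive_reflect u (tau s r : R) d :
  is_derive (tau + s * r) (1 : R) u d ->
  is_derive r (1 : R) (fun r => u (tau + s * r)) (s *: d).
Proof.
move=> [du <-].
have aff : is_derive r (1 : R) (fun r : R => tau + s * r) s.
  apply/is_derive_cvgP; apply: cvg_near_cst.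
  apply: filterS (nbhs_dnbhs_neq (0 : R)) => h h0.
  rewrite [LHS](_ : _ = h^-1 * (tau + s * (h + r) - (tau + s * r)))//; field.
  exact: h0.
have da : differentiable (fun r : R => tau + s * r) r.
  by apply/derivable1_diffP; have [] := aff.
have du' : differentiable u (tau + s * r) by apply/derivable1_diffP.
have dc := differentiable_comp da du'.
apply: DeriveDef; first exact/derivable1_diffP.
have e : 'd (fun r : R => tau + s * r) r 1 = s.
  by rewrite -deriveE//; have [] := aff.
rewrite (deriveE _ dc) (diff_comp da du') /= e (deriveE _ du').
have l := linearZ_LR ('d u (tau + s * r) : {linear R -> W}) s (1 : R).
by rewrite -l [s *: 1]mulr1.
Qed.

End derivative_reflect.

Section comparison.
Variables (R : realType) (n : nat) (N : 'cV[R]_n -> R).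
Hypothesis hN : is_norm N.

(** [N] need not be differentiable, so N (w t) is never differentiated: at the first contact of N w
    with [psi], the norm of the difference quotient of [w] is compared with the quotient of [psi]
    over a short step to the left. *)
Lemma comparison_strict (w w' : R -> 'cV[R]_n) (psi psi' : R -> R) (a b : R) :
  continuous w -> continuous psi ->
  (forall t, a < t < b -> is_derive t (1 : R) w (w' t)) ->
  (forall t, a < t < b -> is_derive t (1 : R) psi (psi' t)) ->
  N (w a) < psi a ->
  (forall t, a < t < b -> N (w t) = psi t -> N (w' t) < psi' t) ->
  forall t, a <= t <= b -> N (w t) <= psi t.
Proof.
move=> cw cpsi dw dpsi h0 hlt t1 /andP[at1 t1b]; rewrite leNgt; apply/negP => bad.
have cNw : continuous (N \o w).
  by move=> x; apply: continuous_comp; [exact: cw|exact: (is_norm_continuous hN)].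
(* The infimum [c] of S is the first contact time: the inequality is strict on [a, c) and an
   equality at [c]. *)
pose S : set R := [set s | a <= s /\ psi s <= N (w s)].
have S1 : S t1 by split=> //; exact: ltW.
have lbS : has_lbound S by exists a => s [].
have hi : has_inf S by split => //; exists t1.
pose c := inf S.
have ac : a <= c by apply: lb_le_inf; [exists t1 | move=> s []].
have ct1 : c <= t1 by apply: ge_inf.
have below s : a <= s -> s < c -> N (w s) < psi s.
  move=> as_ sc; rewrite ltNge; apply/negP => h.
  by have := ge_inf lbS (conj as_ h); rewrite leNgt sc.
have le1 : psi c <= N (w c).
  rewrite leNgt; apply/negP => h.
  have /nbhs_ballP[e /= e0 he] : \forall s \near c, N (w s) < psi s.
    have hd : {for c, continuous (fun s => psi s - N (w s))}.
      by apply: continuousB; [exact: cpsi|exact: cNw].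
    have : \forall s \near c, 0 < psi s - N (w s).
      by apply: (cvgr_gt _ hd); rewrite subr_gt0.
    by apply: filterS => s; rewrite subr_gt0.
  have [s Ss sce] := inf_adherent e0 hi.
  have cs : c <= s by exact: ge_inf.
  case: Ss => as_; apply/negP; rewrite -ltNge; apply: he.
  rewrite -ball_normE /= ltr_norml; move: sce; rewrite -/c; lra.
have ac' : a < c.
  rewrite lt_neqAle ac andbT; apply: contraTneq h0 => ->.
  by rewrite -leNgt.
have le2 : N (w c) <= psi c.
  rewrite leNgt; apply/negP => h.
  have /nbhs_ballP[e /= e0 he] : \forall s \near c, psi s < N (w s).
    have hd : {for c, continuous (fun s => N (w s) - psi s)}.
      by apply: continuousB; [exact: cNw|exact: cpsi].
    have : \forall s \near c, 0 < N (w s) - psi s.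
      by apply: (cvgr_gt _ hd); rewrite subr_gt0.
    by apply: filterS => s; rewrite subr_gt0.
  pose s := Num.max a (c - e / 2).
  have sa : a <= s by rewrite le_max lexx.
  have sc : s < c by rewrite gt_max ac'/=; lra.
  have : psi s < N (w s).
    apply: he; rewrite -ball_normE /= ltr_norml.
    have : c - e / 2 <= s by rewrite le_max lexx orbT.
    lra.
  by rewrite ltNge (ltW (below s sa sc)).
have eqc : N (w c) = psi c by apply/eqP; rewrite eq_le le1 le2.
have ct1' : c < t1.
  by rewrite lt_neqAle ct1 andbT; apply: contraTneq bad => <-; rewrite eqc ltxx.
have cab : a < c < b by rewrite ac'/= (lt_le_trans ct1').
have /is_derive_cvgP qw := dw c cab.
have /is_derive_cvgP qpsi := dpsi c cab.
have lt := hlt c cab eqc.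
(* A slope strictly between N (w' c) and psi' c. After a short step h < 0 from [c], N (w (h + c))
   exceeds psi c - |h| m, which exceeds psi (h + c); this contradicts strictness before [c]. *)
pose m := (N (w' c) + psi' c) / 2.
have m1 : N (w' c) < m by rewrite /m; lra.
have m2 : m < psi' c by rewrite /m; lra.
have qNw : N (h^-1 *: (w (h + c) - w c)) @[h --> 0^'] --> N (w' c).
  by apply: continuous_cvg qw; exact: (is_norm_continuous hN).
have f1 : \forall h \near (0:R)^', N (h^-1 *: (w (h + c) - w c)) < m.
  exact: (cvgr_lt _ qNw).
have f2 : \forall h \near (0:R)^', m < h^-1 *: (psi (h + c) - psi c).
  exact: (cvgr_gt _ qpsi).
have /nbhs_ballP[e /= e0 he] : \forall h \near (0 : R), h != 0 ->
    N (h^-1 *: (w (h + c) - w c)) < m /\ m < h^-1 *: (psi (h + c) - psi c).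
  exact: filterI f1 f2.
pose h := - (Num.min (e / 2) (c - a)).
have hm : 0 < Num.min (e / 2) (c - a) by rewrite lt_min; apply/andP; split; lra.
have hlt0 : h < 0 by rewrite /h; lra.
have hac : a <= h + c.
  have : Num.min (e / 2) (c - a) <= c - a by rewrite ge_min lexx orbT.
  rewrite /h; lra.
have hb : ball 0 e h.
  rewrite -ball_normE /= sub0r normrN ltr0_norm// /h opprK.
  have : Num.min (e / 2) (c - a) <= e / 2 by rewrite ge_min lexx.
  lra.
clearbody h.
have [g1 g2] := he h hb (ltr0_neq0 hlt0).
have := lt_trans g1 g2; rewrite normZ// normfV ltr0_norm//.
have -> : h^-1 *: (psi (h + c) - psi c) = (- h)^-1 * (psi c - psi (h + c)).
  by rewrite invrN mulNr -mulrN opprB.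
have hc : N (w (h + c)) < psi (h + c) by apply: below => //; lra.
have := norm_sub hN (w c) (w (h + c)); rewrite norm_distC// eqc => g3.
rewrite ltr_pM2l ?invr_gt0 ?oppr_gt0// => g4.
lra.
Qed.

End comparison.

Section derivative_rules.
Variable R : realType.

Lemma is_derive_add (W : normedModType R) (f g : R -> W) t df dg :
  is_derive t (1 : R) f df -> is_derive t (1 : R) g dg ->
  is_derive t (1 : R) (fun s => f s + g s) (df + dg).
Proof. by move=> hf hg; exact: is_deriveD. Qed.

Lemma is_derive_sub (W : normedModType R) (f g : R -> W) t df dg :
  is_derive t (1 : R) f df -> is_derive t (1 : R) g dg ->
  is_derive t (1 : R) (fun s => f s - g s) (df - dg).
Proof. by move=> hf hg; exact: is_deriveB. Qed.

Lemma is_derive_mul (f g : R -> R) t df dg :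
  is_derive t (1 : R) f df -> is_derive t (1 : R) g dg ->
  is_derive t (1 : R) (fun s => f s * g s) (df * g t + f t * dg).
Proof.
move=> hf hg; have -> : df * g t + f t * dg = f t *: dg + g t *: df.
  by rewrite addrC (mulrC df).
exact: is_deriveM.
Qed.

Lemma is_derive_scale (f : R -> R) t df c :
  is_derive t (1 : R) f df -> is_derive t (1 : R) (fun s => c * f s) (c * df).
Proof.
move=> hf; have := is_derive_mul (is_derive_cst c t 1) hf.
by rewrite mul0r add0r.
Qed.

Lemma is_derive_exp_comp (f : R -> R) t df :
  is_derive t (1 : R) f df ->
  is_derive t (1 : R) (fun s => expR (f s)) (df * expR (f t)).
Proof.
move=> hf; have h := is_derive1_comp (is_derive_expR (f t)) hf.
by rewrite mulrC.
Qed.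

Lemma is_derive_exp_scale (c t0 : R) t :
  is_derive t (1 : R) (fun s => expR (c * (s - t0))) (c * expR (c * (t - t0))).
Proof.
apply: is_derive_exp_comp.
have := is_derive_scale c (is_derive_sub (is_derive_id t 1) (is_derive_cst t0 t 1)).
by rewrite subr0 mulr1.
Qed.

Lemma continuous_add (T : topologicalType) (W : normedModType R) (f g : T -> W) :
  continuous f -> continuous g -> continuous (fun s => f s + g s).
Proof. by move=> hf hg x; apply: cvgD; [exact: hf|exact: hg]. Qed.

Lemma continuous_sub (T : topologicalType) (W : normedModType R) (f g : T -> W) :
  continuous f -> continuous g -> continuous (fun s => f s - g s).
Proof. by move=> hf hg x; apply: cvgB; [exact: hf|exact: hg]. Qed.

Lemma nondecreasing_of_derive_ge0 (F F' : R -> R) :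
  (forall t, is_derive t (1 : R) F (F' t)) -> (forall t, 0 <= F' t) ->
  forall a b, a <= b -> F a <= F b.
Proof.
move=> dF F'0 a b ab.
have [|x _ e] := MVT_segment ab (f := F) (df := F') (fun x _ => dF x).
  by apply: continuous_subspaceT => x; exact: is_derive_continuous (dF x).
by rewrite -subr_ge0 e mulr_ge0// subr_ge0.
Qed.

End derivative_rules.

(** * Gronwall inequalities in both time directions *)

Section gronwall.
Variables (R : realType) (n : nat) (N : 'cV[R]_n -> R).
Hypothesis hN : is_norm N.

(** Adding e exp((L + 1) (s - a)) to [psi] reduces to the strict case: since k <= L, the derivative
    of this term exceeds k times the term by at least the term itself. *)
Lemma comparison (w w' : R -> 'cV[R]_n) (psi psi' k q : R -> R) (L a b : R) :
  continuous w -> continuous psi ->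
  (forall t, a < t < b -> is_derive t (1 : R) w (w' t)) ->
  (forall t, a < t < b -> is_derive t (1 : R) psi (psi' t)) ->
  (forall t, a < t < b -> N (w' t) <= k t * N (w t) + q t) ->
  (forall t, a < t < b -> k t * psi t + q t <= psi' t) ->
  (forall t, a < t < b -> k t <= L) ->
  N (w a) <= psi a ->
  forall t, a <= t <= b -> N (w t) <= psi t.
Proof.
move=> cw cpsi dw dpsi hw hpsi hk h0 t tab; rewrite leNgt; apply/negP => bad.
pose E s := expR ((L + 1) * (s - a)).
have E0 s : 0 < E s by exact: expR_gt0.
(* At [t] the perturbation equals half of the supposed excess of N w over [psi]. *)
pose e := (N (w t) - psi t) / (2 * E t).
have e0 : 0 < e by rewrite divr_gt0 ?mulr_gt0// subr_gt0.
have dE s : is_derive s (1 : R) E ((L + 1) * E s) by exact: is_derive_exp_scale.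
have : N (w t) <= psi t + e * E t.
  apply: (@comparison_strict _ _ _ hN w w' (fun s => psi s + e * E s)
    (fun s => psi' s + e * ((L + 1) * E s)) a b) => //.
  - apply: continuous_add => // x.
    exact: is_derive_continuous (is_derive_scale e (dE x)).
  - by move=> s sab; exact: (is_derive_add (dpsi s sab) (is_derive_scale e (dE s))).
  - by rewrite (le_lt_trans h0)// ltrDl mulr_gt0.
  - move=> s sab es; rewrite (le_lt_trans (hw s sab))// es.
    have h1 := hpsi s sab; have h2 := hk s sab.
    have h3 : 0 < e * E s by rewrite mulr_gt0.
    have : k s * (e * E s) <= L * (e * E s) by rewrite ler_wpM2r// ltW.
    lra.
rewrite /e; have -> : (N (w t) - psi t) / (2 * E t) * E t = (N (w t) - psi t) / 2.
  by field; rewrite gt_eqF.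
lra.
Qed.

Lemma comparison_dir (w w' : R -> 'cV[R]_n) (psi psi' k q : R -> R) (L tau s T : R) :
  `|s| = 1 -> continuous w -> continuous psi ->
  (forall r, 0 < r < T -> is_derive (tau + s * r) (1 : R) w (w' r)) ->
  (forall r, 0 < r < T -> is_derive r (1 : R) psi (psi' r)) ->
  (forall r, 0 < r < T -> N (w' r) <= k r * N (w (tau + s * r)) + q r) ->
  (forall r, 0 < r < T -> k r * psi r + q r <= psi' r) ->
  (forall r, 0 < r < T -> k r <= L) ->
  N (w tau) <= psi 0 ->
  forall r, 0 <= r <= T -> N (w (tau + s * r)) <= psi r.
Proof.
move=> s1 cw cpsi dw dpsi hw hpsi hk h0 r hr.
apply: (@comparison (fun r => w (tau + s * r)) (fun r => s *: w' r) psi psi' k q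
  L 0 T) => //.
- move=> x; apply: (@continuous_comp _ _ _ (fun r => tau + s * r) w); last exact: cw.
  have d := is_derive_add (is_derive_cst tau x 1) (is_derive_scale s (is_derive_id x 1)).
  exact: is_derive_continuous d.
- by move=> x hx; apply: is_derive_reflect; exact: dw.
- by move=> x hx; rewrite normZ// s1 mul1r hw.
- by rewrite mulr0 addr0.
Qed.

(** The base point [s] is arbitrary and [t] may lie on either side of it, because zeta_k may sit
    anywhere in its cell. *)
Lemma gronwall_segment (w w' : R -> 'cV[R]_n) (k q a b : R) :
  0 < k -> continuous w ->
  (forall t, a < t < b -> is_derive t (1 : R) w (w' t)) ->
  (forall t, a < t < b -> N (w' t) <= k * N (w t) + q) ->
  forall s t, a <= s <= b -> a <= t <= b ->
    N (w t) <= expR (k * `|t - s|) * N (w s) + q * ((expR (k * `|t - s|) - 1) / k).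
Proof.
move=> k0 cw dw hw s t sab tab.
have [->|st] := eqVneq t s.
  by rewrite subrr normr0 mulr0 expR0 subrr mul0r mulr0 addr0 mul1r.
(* The solution of psi' = k psi + q with psi 0 = N (w s). *)
pose psi r := expR (k * (r - 0)) * (N (w s) + q / k) - q / k.
have dpsi r : is_derive r (1 : R) psi (k * expR (k * (r - 0)) * (N (w s) + q / k)).
  have := is_derive_sub (is_derive_mul (is_derive_exp_scale k 0 r)
    (is_derive_cst (N (w s) + q / k) r 1)) (is_derive_cst (q / k) r 1).
  by rewrite subr0 mulr0 addr0.
pose sg := Num.sg (t - s); pose T := `|t - s|.
have T0 : 0 <= T by exact: normr_ge0.
have e : t = s + sg * T by rewrite /sg /T -numEsg addrC subrK.
have hr r : 0 < r < T -> a < s + sg * r < b.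
  rewrite /sg /T; have [ts|ts|ts] := ltrgt0P (t - s).
  - by rewrite gtr0_sg// mul1r; lra.
  - by rewrite ltr0_sg// mulN1r; lra.
  - by move/eqP: ts; rewrite subr_eq0 (negbTE st).
have -> : expR (k * `|t - s|) * N (w s) + q * ((expR (k * `|t - s|) - 1) / k) = psi T.
  by rewrite /psi subr0; field; rewrite gt_eqF.
rewrite {1}e.
apply: (@comparison_dir w (fun r => w' (s + sg * r)) psi
  (fun r => k * expR (k * (r - 0)) * (N (w s) + q / k)) (cst k) (cst q) k s sg T) => //.
- by rewrite normr_sg subr_eq0 st.
- by move=> r; apply: is_derive_continuous (dpsi r).
- by move=> r /hr; exact: dw.
- by move=> r /hr; exact: hw.
- move=> r _ /=; rewrite /psi le_eqVlt; apply/orP; left; apply/eqP; field.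
  by rewrite gt_eqF.
- by rewrite /psi subrr mulr0 expR0 mul1r addrK.
- by rewrite T0 lexx.
Qed.

End gronwall.

(** * Antiderivatives and fixed points *)

Section antiderivative.
Variable R : realType.
Notation mu := lebesgue_measure.

Lemma integral_of_derive (f F : R -> R) a b : a <= b ->
  continuous f -> (forall t, is_derive t (1 : R) F (f t)) ->
  \int[mu]_(x in `[a, b]) f x = F b - F a.
Proof.
rewrite le_eqVlt => /predU1P[->|ab] cf dF.
  by rewrite set_itv1 Rintegral_set1 subrr.
have cF : continuous F by move=> x; exact: is_derive_continuous (dF x).
rewrite /Rintegral (@continuous_FTC2 _ f F)//.
- exact: continuous_subspaceT.
- split=> [x _||]; first by have [] := dF x.
  + by apply: cvg_at_right_filter; exact: cF.
  + by apply: cvg_at_left_filter; exact: cF.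
- by move=> x _; rewrite derive1E; have [] := dF x.
Qed.

(** The fundamental theorem of calculus gives a primitive from each left endpoint -m. Subtracting
    its value at 0 makes the primitives for different m agree, and at x the one with m above |x| is
    used. *)
Lemma antiderivative (f : R -> R) : continuous f ->
  exists F, forall t, is_derive t (1 : R) F (f t).
Proof.
move=> cf.
pose I (m : nat) (x : R) : R := \int[mu]_(t in `[(- m%:R), x]) f t.
have dI m (x : R) : - m%:R < x -> is_derive x (1 : R) (I m) (f x).
  move=> mx; have [||d1 d2] := @continuous_FTC1_closed R f (- m%:R) x (x + 1) _ _ mx (cf x).
  - by rewrite ltrDl.
  - apply: continuous_compact_integrable; first exact: segment_compact.
    exact: continuous_subspaceT.
  - by apply: (DeriveDef d1); rewrite -derive1E.
pose G m (x : R) := I m x - I m 0.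
have GG (m p : nat) (x : R) : `|x| < m%:R -> (m <= p)%N -> G m x = G p x.
  move=> xm mp.
  have m0 : 0 < m%:R :> R by exact: le_lt_trans xm.
  have mpR : (m%:R : R) <= p%:R by rewrite ler_nat.
  have d (y : R) : - m%:R < y -> is_derive y (1 : R) (fun y => I m y - I p y) 0.
    move=> my; rewrite -(subrr (f y)); apply: is_derive_sub; apply: dI => //.
    by rewrite (le_lt_trans _ my)// lerN2.
  have cst_on (a b : R) : - m%:R < a -> a <= b -> I m b - I p b = I m a - I p a.
    move=> ma ab; apply/eqP; rewrite -subr_eq0; apply/eqP.
    have [||c _ ->] := MVT_segment ab (f := fun y => I m y - I p y) (df := cst 0).
    - by move=> y; rewrite in_itv/= => /andP[ay _]; apply: d; exact: lt_trans ay.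
    - apply: derivable_within_continuous => y; rewrite in_itv/= => /andP[ay _].
      by have [] := d y (lt_le_trans ma ay).
    - by rewrite mul0r.
  have : I m x - I p x = I m 0 - I p 0.
    have [x0|x0] := leP 0 x; first by rewrite (cst_on 0 x)// ltrNl oppr0.
    rewrite (cst_on x 0)// ?ltW//; move: xm; rewrite ltr_norml; lra.
  rewrite /G; lra.
have dG m (x : R) : `|x| < m%:R -> is_derive x (1 : R) (G m) (f x).
  rewrite ltr_norml => /andP[mx _]; rewrite -(subr0 (f x)).
  exact: is_derive_sub (dI m x mx) (is_derive_cst _ x 1).
clearbody G; clear dI; clear I.
pose b (x : R) := Num.bound `|x|.
have hb (x : R) : `|x| < (b x)%:R by apply: archi_boundP.
exists (fun x => G (b x) x) => x.
(* For this m, [G m] is a primitive on the whole unit ball about [x] and agrees there with the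
   pointwise choice. *)
pose m := (b (`|x| + 1)).
have hm : `|x| + 1 < m%:R by rewrite (le_lt_trans (ler_norm _)).
have xm : `|x| < m%:R by lra.
apply: near_eq_is_derive (dG m x xm).
apply/nbhs_ballP; exists 1 => //= y; rewrite -ball_normE/= distrC => yx.
have ym : `|y| < m%:R.
  have := ler_normD (y - x) x; rewrite subrK; lra.
have [mp|pm] := leqP m (b y); first exact: GG.
by apply/esym/GG => //; exact: ltnW.
Qed.

Lemma is_derive_mx n p (F f : R -> 'M[R]_(n, p)) t :
  (forall i j, is_derive t (1 : R) (fun t => F t i j) (f t i j)) ->
  is_derive t (1 : R) F (f t).
Proof.
move=> h; have d : derivable F t 1 by apply/derivable_mxP => i j; have [] := h i j.
apply: DeriveDef => //; apply/matrixP => i j; rewrite derive_mx// mxE.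
by have [] := h i j.
Qed.

Lemma antiderivative_mx n p (f : R -> 'M[R]_(n, p)) : continuous f ->
  exists F : R -> 'M[R]_(n, p), forall t, is_derive t (1 : R) F (f t).
Proof.
move=> cf.
have h i j : exists F, forall t, is_derive t (1 : R) F (f t i j).
  apply: antiderivative => t.
  apply: (@continuous_comp _ _ _ f (fun M : 'M[R]_(n, p) => M i j)); first exact: cf.
  exact: coord_continuous.
exists (fun t => \matrix_(i, j) projT1 (cid (h i j)) t) => t.
apply: is_derive_mx => i j; under eq_fun do rewrite mxE.
exact: projT2 (cid (h i j)) t.
Qed.

End antiderivative.

(** * Contraction principle in a weighted norm *)

Section weighted_fixpoint.
Variables (R : realType) (n : nat) (N : 'cV[R]_n -> R).
Hypothesis hN : is_norm N.

Lemma norm_series_cvg (u : nat -> 'cV[R]_n) (b : nat -> R) :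
  (forall m, N (u m) <= b m) -> cvgn (series b) -> cvgn (series u).
Proof.
move=> ub cb; have [c c0 hc] := norm_ge_sup hN.
have : cvgn [normed series u].
  apply: (@series_le_cvg _ _ (fun m => c * b m)) => [m|m|m|].
  - exact: normr_ge0.
  - by rewrite mulr_ge0 ?(ltW c0)// (le_trans (norm_ge0 hN (u m))).
  - by rewrite (le_trans (hc _))// ler_wpM2l ?(ltW c0).
  - exact: (@is_cvg_seriesZ R b c cb).
move=> /cauchy_cvgP/cauchy_seriesP u_ncvg.
apply/cauchy_cvgP/cauchy_seriesP => e /u_ncvg.
apply: filterS => m /=; rewrite ger0_norm ?sumr_ge0//.
by apply: le_lt_trans; apply: ler_norm_sum.
Qed.

Lemma geometric_small (C q e : R) : 0 <= q < 1 -> 0 < e ->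
  exists m, C * q ^+ m < e.
Proof.
move=> /andP[q0 q1] e0.
have h : (fun m => C * q ^+ m) @ \oo --> (0 : R).
  by apply: cvg_geometric; rewrite ger0_norm.
have [m _ hm] : \forall m \near \oo, C * q ^+ m < e by exact: (cvgr_lt _ h).
by exists m; apply: hm => /=.
Qed.

(** Banach's fixed point theorem for the distance sup N (u - v) / phi. The weight may be unbounded;
    being continuous, it is locally bounded, so the iterates converge locally uniformly and the
    limit is continuous. *)
Lemma weighted_fixpoint (phi : R -> R) (T : (R -> 'cV[R]_n) -> R -> 'cV[R]_n)
    (q c0 : R) (u0 : R -> 'cV[R]_n) :
  0 <= q < 1 -> continuous phi -> (forall t, 0 <= phi t) ->
  (forall u : R -> 'cV[R]_n, continuous u -> continuous (T u)) ->
  (forall (u v : R -> 'cV[R]_n) (c : R), continuous u -> continuous v -> 0 <= c ->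
    (forall t, N (u t - v t) <= c * phi t) ->
    forall t, N (T u t - T v t) <= q * c * phi t) ->
  continuous u0 -> 0 <= c0 -> (forall t, N (T u0 t - u0 t) <= c0 * phi t) ->
  exists2 u : R -> 'cV[R]_n, continuous u & T u = u.
Proof.
move=> /andP[q0 q1] cphi phi0 cT hT cu0 c00 h0.
have q01 : 0 <= q < 1 by rewrite q0 q1.
pose u_ m := iter m T u0.
have cu m : continuous (u_ m) by elim: m => //= m IH; exact: cT.
have step m t : N (u_ m.+1 t - u_ m t) <= c0 * phi t * q ^+ m.
  have : N (u_ m.+1 t - u_ m t) <= q ^+ m * c0 * phi t.
    elim: m t => [|m IH] t; first by rewrite expr0 mul1r h0.
    rewrite exprS -[q * _ * _]mulrA; apply: hT => //; first exact: (cu m.+1).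
    by rewrite mulr_ge0// exprn_ge0.
  by have -> : q ^+ m * c0 * phi t = c0 * phi t * q ^+ m by ring.
(* B t q^m is the tail of the geometric series that bounds the successive steps at [t]. *)
pose B t := c0 * phi t / (1 - q).
have q1' : 0 < 1 - q by rewrite subr_gt0.
have B0 t : 0 <= B t by rewrite /B divr_ge0 ?mulr_ge0// ltW.
have far m k t : N (u_ (m + k)%N t - u_ m t) <= B t * (q ^+ m - q ^+ (m + k)).
  elim: k => [|k IH]; first by rewrite addn0 !subrr norm0// mulr0.
  rewrite addnS -(subrK (u_ (m + k)%N t) (u_ _.+1 t)) -addrA.
  rewrite (le_trans (normD hN _ _))// (le_trans (lerD (step _ _) IH))//.
  rewrite exprS /B le_eqVlt; apply/orP; left; apply/eqP; field.
  by rewrite gt_eqF.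
have [c c_gt0 hc] := norm_ge_sup hN.
have cv t : cvgn (fun m => u_ m t).
  pose d m := u_ m.+1 t - u_ m t.
  have -> : (fun m => u_ m t) = (fun m => u_ 0%N t + series d m).
    apply/funext => m; rewrite /series/= /d.
    by rewrite (telescope_sumr (fun m => u_ m t))// addrC subrK.
  apply: is_cvgD; first exact: is_cvg_cst.
  apply: (@norm_series_cvg _ (geometric (c0 * phi t) q)) => [m|].
    exact: step.
  by apply: is_cvg_geometric_series; rewrite ger0_norm.
pose u (t : R) : 'cV[R]_n := lim ((fun m => u_ m t) @ \oo).
have err m t : N (u t - u_ m t) <= B t * q ^+ m.
  have cvN : (fun k => N (u_ (m + k)%N t - u_ m t)) @ \oo --> N (u t - u_ m t).
    apply: continuous_cvg; first exact: (is_norm_continuous hN).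
    apply: cvgB; last exact: cvg_cst.
    rewrite (_ : (fun k => u_ (m + k)%N t) = (fun k => u_ (k + m)%N t)); last first.
      by apply/funext => k; rewrite addnC.
    have := cv t; rewrite -(cvg_shiftn m (fun k => u_ k t)); exact.
  rewrite -(cvg_lim _ cvN)//; apply: limr_le; first by apply/cvg_ex; eexists; exact: cvN.
  apply: nearW => k; rewrite (le_trans (far m k t))// ler_wpM2l//.
  by rewrite lerBlDr lerDl exprn_ge0.
have cu' : continuous u.
  move=> t; apply/cvgrPdist_lt => e e0.
  have e3 : 0 < e / c / 3 by rewrite !divr_gt0.
  (* Where phi s < phi t + 1, the constant B s is at most B t + c0 / (1 - q), so one [m] serves all
     s near t. *)
  have [m hm] := geometric_small (B t + c0 / (1 - q)) q01 e3.
  have n1 : \forall s \near t, phi s < phi t + 1 by apply: (cvgr_lt _ (cphi t)); lra.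
  have [C C0 hC] := norm_le_sup hN.
  have e3' : 0 < e / c / 3 / C by rewrite divr_gt0.
  have /cvgrPdist_lt/(_ _ e3') n2 := cu m t.
  apply: filterS2 n1 n2 => s s1 s2.
  rewrite (le_lt_trans (hc _))// mulrC -ltr_pdivlMr//.
  have -> : u t - u s = (u t - u_ m t) + (u_ m t - u_ m s) + (u_ m s - u s).
    by rewrite !addrA !subrK.
  have a1 := err m t; have a2 := err m s; rewrite norm_distC// in a2.
  have a3 : N (u_ m t - u_ m s) < e / c / 3.
    by rewrite (le_lt_trans (hC _))// mulrC -ltr_pdivlMr.
  have qm : 0 <= q ^+ m by rewrite exprn_ge0.
  have a4 : B t * q ^+ m <= (B t + c0 / (1 - q)) * q ^+ m.
    by rewrite ler_wpM2r// lerDl divr_ge0// ltW.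
  have a5 : B s * q ^+ m <= (B t + c0 / (1 - q)) * q ^+ m.
    rewrite ler_wpM2r// /B -mulrDl -[X in _ * _ + X]mulr1 -mulrDr.
    by rewrite ler_wpM2r ?invr_ge0 ?(ltW q1')// ler_wpM2l// ltW.
  have a6 := normD hN (u t - u_ m t + (u_ m t - u_ m s)) (u_ m s - u s).
  have a7 := normD hN (u t - u_ m t) (u_ m t - u_ m s).
  lra.
exists u => //; apply/funext => t; apply/eqP; rewrite -subr_eq0; apply/eqP.
apply: (norm_eq0 hN); apply/eqP; rewrite eq_le norm_ge0// andbT leNgt.
apply/negP => pos.
have [m] := geometric_small (B t + B t) q01 pos.
apply/negP; rewrite -leNgt.
have b1 : N (T u t - u_ m.+1 t) <= q * (c0 / (1 - q) * q ^+ m) * phi t.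
  apply: hT => //; first by rewrite mulr_ge0 ?exprn_ge0// divr_ge0// ltW.
  move=> s; rewrite (le_trans (err m s))// /B le_eqVlt; apply/orP; left; apply/eqP.
  by field; rewrite gt_eqF.
have b2 := err m.+1 t; rewrite norm_distC// in b2.
have := normD hN (T u t - u_ m.+1 t) (u_ m.+1 t - u t).
rewrite addrA subrK => h; rewrite (le_trans h)// mulrDl.
have e1 : q * (c0 / (1 - q) * q ^+ m) * phi t = q * (B t * q ^+ m).
  by rewrite /B; field; rewrite gt_eqF.
have b3 : q * (B t * q ^+ m) <= B t * q ^+ m.
  by rewrite ler_piMl ?(ltW q1)// mulr_ge0// exprn_ge0.
rewrite exprS in b2; rewrite e1 in b1.
have e2 : B t * (q * q ^+ m) = q * (B t * q ^+ m) by rewrite mulrCA.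
lra.
Qed.

End weighted_fixpoint.

(** * The equation with deviated argument frozen at one point *)

Section frozen_argument.
Variables (R : realType) (n : nat) (N : 'cV[R]_n -> R).
Hypothesis hN : is_norm N.
Variables (a b theta : R).
Hypotheses (a0 : 0 < a) (b0 : 0 < b) (theta0 : 0 < theta).
Hypothesis smallness : b * ((expR (a * theta) - 1) / a) < 1.

Lemma mean_value_from (w w' : R -> 'cV[R]_n) (psi psi' : R -> R) (tau : R) :
  (forall t, is_derive t (1 : R) w (w' t)) ->
  (forall r, is_derive r (1 : R) psi (psi' r)) ->
  (forall t, N (w' t) <= psi' `|t - tau|) ->
  forall t, N (w t - w tau) <= psi `|t - tau| - psi 0.
Proof.
move=> dw dpsi hw t.
have [->|tt] := eqVneq t tau; first by rewrite !subrr normr0 subrr norm0.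
pose s := Num.sg (t - tau).
have s1 : `|s| = 1 by rewrite normr_sg subr_eq0 tt.
have e : t = tau + s * `|t - tau| by rewrite /s -numEsg addrC subrK.
rewrite {1}e.
apply: (@comparison_dir _ _ _ hN (fun t => w t - w tau)
  (fun r => w' (tau + s * r)) (fun r => psi r - psi 0) psi' (cst 0) psi' 0
  tau s `|t - tau|) => //.
- apply: continuous_sub; last exact: cst_continuous.
  by move=> x; exact: is_derive_continuous (dw x).
- apply: continuous_sub; last exact: cst_continuous.
  by move=> x; exact: is_derive_continuous (dpsi x).
- move=> r _; have := is_derive_sub (dw (tau + s * r)) (is_derive_cst (w tau) (tau + s * r) (1 : R)).
  by rewrite subr0.
- by move=> r _; have := is_derive_sub (dpsi r) (is_derive_cst (psi 0) r (1 : R)); rewrite subr0.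
- move=> r /andP[r0 _]; rewrite /cst mul0r add0r (le_trans (hw _))//.
  by rewrite addrAC subrr add0r normrM s1 mul1r gtr0_norm.
- by move=> r _; rewrite /cst mul0r add0r.
- by rewrite !subrr norm0.
- by rewrite lexx normr_ge0.
Qed.

(* The weight [(1 + kappa) exp (lambda |t - tau|) - kappa], with [lambda]
   slightly larger than [a], makes the Picard operator of the equation a
   contraction on the whole real line. *)
Lemma frozen_ivp (G : R -> 'cV[R]_n -> 'cV[R]_n -> 'cV[R]_n) (m tau zeta : R)
    (xi : 'cV[R]_n) :
  (forall u y, continuous u -> continuous (fun t => G t (u t) y)) ->
  (forall t x x' y y', N (G t x y - G t x' y') <= a * N (x - x') + b * N (y - y')) ->
  (forall t, N (G t 0 0) <= m) ->
  `|zeta - tau| <= theta ->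
  exists2 u : R -> 'cV[R]_n, forall t, is_derive t (1 : R) u (G t (u t) (u zeta)) & u tau = xi.
Proof.
move=> cG lG mG hz.
(* Smallness says exp(a theta) < 1 + a / b. [E] is the midpoint, and [lambda] > a is defined by
   exp(lambda theta) = E. *)
pose E := (expR (a * theta) + 1 + a / b) / 2.
have sE : expR (a * theta) < 1 + a / b.
  rewrite -ltrBlDl ltr_pdivlMr// mulrC.
  by move: smallness; rewrite mulrA ltr_pdivrMr// mul1r.
have eE : expR (a * theta) < E by rewrite /E; lra.
have Es : E < 1 + a / b by rewrite /E; lra.
have E0 : 0 < E by rewrite (lt_trans _ eE)// expR_gt0.
pose lambda := ln E / theta.
have lE : expR (lambda * theta) = E by rewrite /lambda divfK ?gt_eqF// lnK.
have al : a < lambda.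
  by rewrite -(ltr_pM2r theta0) -ltr_expR lE.
have l0 : 0 < lambda by exact: lt_trans al.
have E1 : 1 < E.
  by rewrite -lE -expR0 ltr_expR mulr_gt0.
pose v := b / a * (E - 1).
have v1 : v < 1.
  rewrite /v mulrAC ltr_pdivrMr// mul1r mulrC -ltr_pdivlMr//.
  by rewrite ltrBlDl.
(* [B] is to be psi theta while kappa = b B / a; together these require B = E + v B. *)
pose B := E / (1 - v).
have B0 : 0 < B by rewrite divr_gt0// subr_gt0.
pose kappa := b / a * B.
have k0 : 0 < kappa by rewrite /kappa mulr_gt0// divr_gt0.
have BE : B = (1 + kappa) * E - kappa.
  rewrite /kappa; have -> : (1 + b / a * B) * E - b / a * B = E + v * B by rewrite /v; ring.
  by rewrite /B; field; rewrite gt_eqF// subr_gt0.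
pose psi r := (1 + kappa) * expR (lambda * (r - 0)) - kappa.
pose psi' r := (1 + kappa) * (lambda * expR (lambda * (r - 0))).
have dpsi r : is_derive r (1 : R) psi (psi' r).
  have := is_derive_sub (is_derive_scale (1 + kappa) (is_derive_exp_scale lambda 0 r))
    (is_derive_cst kappa r 1).
  by rewrite subr0.
(* The Lipschitz bound a psi + b B of the right-hand side is the fraction a / lambda < 1 of psi';
   this fraction is the contraction factor. *)
have psi_id r : a * psi r + b * B = a / lambda * psi' r.
  rewrite /psi /psi' /kappa; field; rewrite !gt_eqF//.
have psi_mono r s : r <= s -> psi r <= psi s.
  move=> rs; rewrite lerD2r ler_wpM2l ?ler_expR ?ler_wpM2l ?lerD2r//; lra.
have psi0 : psi 0 = 1 by rewrite /psi subrr mulr0 expR0 mulr1 addrK.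
have psith : psi theta = B by rewrite /psi subr0 lE BE.
pose q := a / lambda.
have q0 : 0 < q by rewrite divr_gt0.
have q1 : q < 1 by rewrite /q ltr_pdivrMr// mul1r.
pose phi t := psi `|t - tau|.
have phi1 t : 1 <= phi t by rewrite -psi0 psi_mono// normr_ge0.
have cphi : continuous phi.
  move=> t; apply: (@continuous_comp _ _ _ (fun t => `|t - tau|) psi); last first.
    exact: is_derive_continuous (dpsi _).
  apply: (@continuous_comp _ _ _ (fun t => t - tau) Num.norm); last exact: norm_continuous.
  exact: (continuous_sub (fun x => @cvg_id _ (nbhs x)) (@cst_continuous _ _ tau)).
pose rhs (u : R -> 'cV[R]_n) t := G t (u t) (u zeta).
pose prim (u : R -> 'cV[R]_n) : R -> 'cV[R]_n :=
  get (fun F : R -> 'cV[R]_n => forall t, is_derive t (1 : R) F (rhs u t)).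
have dprim u : continuous u -> forall t, is_derive t (1 : R) (prim u) (rhs u t).
  move=> cu; have [F dF] := antiderivative_mx (cG u (u zeta) cu).
  exact: (getPex (ex_intro (fun F => forall t, is_derive t (1 : R) F (rhs u t)) F dF)).
pose T u t := prim u t - (prim u tau - xi).
have dT u : continuous u -> forall t, is_derive t (1 : R) (T u) (rhs u t).
  move=> cu t.
  have := is_derive_sub (dprim u cu t) (is_derive_cst (prim u tau - xi) t 1).
  by rewrite subr0.
have Ttau u : T u tau = xi by rewrite /T opprB addrC subrK.
have m0 : 0 <= m by rewrite (le_trans _ (mG 0))// norm_ge0.
(* [m1] bounds the right-hand side along the constant [xi]. The first Picard step is then at most m1
   |t - tau|, hence at most (m1 / lambda) phi t. *)
pose m1 := (a + b) * N xi + m.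
have m10 : 0 <= m1 by rewrite /m1 addr_ge0// mulr_ge0 ?norm_ge0// addr_ge0// ltW.
have [||t|u cu x|u v' c cu cv c0 huv t|||t|u cu Tu] := @weighted_fixpoint _ _ _ hN phi T q (m1 / lambda) (cst xi).
- by rewrite q1 ltW.
- exact: cphi.
- by rewrite (le_trans ler01).
- exact: is_derive_continuous (dT u cu x).
- have dw s := is_derive_sub (dT u cu s) (dT v' cv s).
  have dpsi' r := is_derive_scale (c * q) (dpsi r).
  have := mean_value_from dw dpsi' (tau := tau) _ t.
  rewrite !Ttau subrr subr0 psi0 mulr1 => /(_ _)/le_trans; apply => [s|]; last first.
    by rewrite (mulrC q) /phi lerBlDr lerDl mulr_ge0// ltW.
  rewrite (le_trans (lG _ _ _ _ _))// -mulrA -psi_id mulrDr.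
  have h1 := huv s; have h2 : N (u zeta - v' zeta) <= c * B.
    by rewrite (le_trans (huv zeta))// ler_wpM2l// -psith psi_mono.
  rewrite mulrCA (mulrCA c) lerD// ler_wpM2l// ltW//.
- by move=> x; exact: cst_continuous.
- by rewrite divr_ge0// ltW.
- have dw s := dT (cst xi) (@cst_continuous _ _ xi) s.
  have dm (r : R) := is_derive_scale m1 (is_derive_id r (1 : R)).
  have := mean_value_from dw dm (tau := tau) _ t.
  rewrite !Ttau mulr0 subr0 => /(_ _)/le_trans; apply => [s|].
    rewrite mulr1 /rhs /cst /= -(subrK (G s 0 0) (G s xi xi)).
    rewrite (le_trans (normD hN _ _))// lerD// (le_trans (lG _ _ _ _ _))//.
    by rewrite !subr0 mulrDl.
  rewrite -mulrA ler_wpM2l// ler_pdivlMl//.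
  apply: (@le_trans _ _ (expR (lambda * `|t - tau|))).
    by rewrite (le_trans _ (expR_ge1Dx _))// lerDr.
  rewrite /phi /psi subr0 mulrDl mul1r -addrA lerDl subr_ge0.
  by rewrite ler_peMr ?(ltW k0)// -expR0 ler_expR mulr_ge0// ltW.
by exists u => [t|]; [rewrite -{1}Tu; exact: dT | rewrite -Tu Ttau].
Qed.

(** With e = exp(a theta) and v = b (e - 1) / a < 1, Gronwall gives N (w t) <= e N (w s) + v N (w
    zeta). Solving this at t = zeta and substituting back yields e + v e / (1 - v) = e / (1 - v). *)
Definition growth := expR (a * theta) / (1 - b * ((expR (a * theta) - 1) / a)).

Lemma growth_gt0 : 0 < growth.
Proof. by rewrite divr_gt0 ?expR_gt0// subr_gt0. Qed.

Lemma frozen_growth (w w' : R -> 'cV[R]_n) (t0 t1 zeta : R) :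
  t1 - t0 <= theta -> t0 <= zeta <= t1 -> continuous w ->
  (forall t, t0 < t < t1 -> is_derive t (1 : R) w (w' t)) ->
  (forall t, t0 < t < t1 -> N (w' t) <= a * N (w t) + b * N (w zeta)) ->
  forall s t, t0 <= s <= t1 -> t0 <= t <= t1 -> N (w t) <= growth * N (w s).
Proof.
move=> le_th hz cw dw hw s t hs ht.
have g := gronwall_segment hN a0 cw dw hw.
pose e := expR (a * theta); pose v := b * ((e - 1) / a).
have e0 : 0 < e by exact: expR_gt0.
have eb x : t0 <= x <= t1 -> expR (a * `|x - s|) <= e.
  by move=> hx; rewrite ler_expR ler_wpM2l ?(ltW a0)// ler_norml; lra.
have g' x : t0 <= x <= t1 -> N (w x) <= e * N (w s) + v * N (w zeta).
  move=> hx; rewrite (le_trans (g s x hs hx))// lerD//.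
    by rewrite ler_wpM2r ?norm_ge0// eb.
  have -> : v * N (w zeta) = b * N (w zeta) * ((e - 1) / a) by rewrite /v; ring.
  apply: ler_wpM2l; first by rewrite mulr_ge0 ?norm_ge0// ltW.
  by rewrite ler_wpM2r ?invr_ge0 ?(ltW a0)// lerD2r eb.
have v1 : 0 < 1 - v by rewrite subr_gt0.
have z1 : N (w zeta) <= e / (1 - v) * N (w s).
  rewrite mulrAC ler_pdivlMr//.
  have := g' zeta hz; lra.
have v0 : 0 <= v.
  rewrite /v mulr_ge0 ?(ltW b0)// divr_ge0 ?(ltW a0)// subr_ge0 -expR0 ler_expR.
  by rewrite mulr_ge0// ltW.
rewrite (le_trans (g' t ht))//.
have -> : growth * N (w s) = e * N (w s) + v * (e / (1 - v) * N (w s)).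
  rewrite /growth -/e -/v; field; rewrite gt_eqF//.
by rewrite lerD2l ler_wpM2l.
Qed.

End frozen_argument.

(** * Cauchy problem with piecewise constant argument *)

(** Recursion by choice in both directions from [k0]: a cell determines its right neighbour through
    [up] and its left neighbour through [down]. *)
Lemma int_chain (X : Type) (S : int -> X -> Prop) (r : int -> X -> X -> Prop)
    (k0 : int) (x0 : X) :
  S k0 x0 ->
  (forall k x, S k x -> exists y, S (k + 1) y /\ r k x y) ->
  (forall k y, S (k + 1) y -> exists x, S k x /\ r k x y) ->
  exists U : int -> X,
    U k0 = x0 /\ forall k, S k (U k) /\ r k (U k) (U (k + 1)).
Proof.
move=> S0 up down.
pose nx k x := if pselect (exists y, S (k + 1) y /\ r k x y) is left h
  then projT1 (cid h) else x0.
have nxP k x : S k x -> S (k + 1) (nx k x) /\ r k x (nx k x).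
  by move=> Sx; rewrite /nx; case: pselect => [h|[]]; [exact: projT2 (cid h)|exact: up].
pose pv k y := if pselect (exists x, S k x /\ r k x y) is left h
  then projT1 (cid h) else x0.
have pvP k y : S (k + 1) y -> S k (pv k y) /\ r k (pv k y) y.
  by move=> Sy; rewrite /pv; case: pselect => [h|[]]; [exact: projT2 (cid h)|exact: down].
pose F := fix F (m : nat) := if m is p.+1 then nx (k0 + p%:Z) (F p) else x0.
pose B := fix B (m : nat) := if m is p.+1 then pv (k0 - p.+1%:Z) (B p) else x0.
have SF m : S (k0 + m%:Z) (F m).
  elim: m => [|m IH]; first by rewrite addr0.
  have -> : k0 + m.+1%:Z = k0 + m%:Z + 1 by lia.
  by have [] := nxP _ _ IH.
have SB m : S (k0 - m%:Z) (B m).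
  elim: m => [|m IH]; first by rewrite subr0.
  have e : k0 - m%:Z = k0 - m.+1%:Z + 1 by lia.
  by rewrite e in IH; have [] := pvP _ _ IH.
(* [Negz m] is -(m + 1), hence [B m.+1]. *)
exists (fun k => match k - k0 with Posz m => F m | Negz m => B m.+1 end).
split=> [|k]; first by rewrite subrr.
case E : (k - k0) => [m|m].
  have -> : k = k0 + m%:Z by lia.
  have -> : k0 + m%:Z + 1 - k0 = Posz m.+1 by lia.
  by split; [exact: SF|have [] := nxP _ _ (SF m)].
have ke : k = k0 - m.+1%:Z by lia.
split; first by rewrite ke; exact: SB.
have e : k0 - m%:Z = k + 1 by lia.
have := SB m; rewrite e => /pvP[_]; rewrite /= -ke.
case: m E ke e => [|m] E ke e.
  by have -> : k + 1 - k0 = Posz 0 by lia.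
by have -> : k + 1 - k0 = Negz m by lia.
Qed.

Section cells.
Variables (R : realType) (t_ zeta : int -> R) (theta : R).
Hypothesis hseq : pca_seqs t_ zeta theta.

Lemma node_lt i j : i < j -> t_ i < t_ j.
Proof.
have [h _ _ _] := hseq.
have {}h m : t_ i < t_ (i + m.+1%:Z).
  elim: m => [|m IH]; first exact: h.
  have -> : i + m.+2%:Z = i + m.+1%:Z + 1 by lia.
  exact: lt_trans IH (h _).
move=> ij; have -> : j = i + (`|j - i|%N.-1).+1%:Z by lia.
exact: h.
Qed.

Lemma node_le i j : i <= j -> t_ i <= t_ j.
Proof. by rewrite le_eqVlt => /predU1P[->//|/node_lt/ltW]. Qed.

Lemma node_step i : t_ (i + 1) - t_ i <= theta.
Proof. by have [_ _ _] := hseq; apply. Qed.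

Lemma zeta_in i : t_ i <= zeta i <= t_ (i + 1).
Proof. by have [_ h _ _] := hseq; exact: h. Qed.

Lemma cell_exists t : exists i, t_ i <= t < t_ (i + 1).
Proof.
have [_ _ [hp hm] _] := hseq.
have [p _ hp'] : \forall k \near \oo, t + 1 <= t_ k%:Z by exact: (cvgryPge _).1 hp _.
have [m _ hm'] : \forall k \near \oo, t_ (- k%:Z) <= t by exact: (cvgrNyPle _).1 hm _.
have tp : t < t_ p%:Z by have := hp' p (leqnn _); rewrite /=; lra.
have mt : t_ (- m%:Z) <= t := hm' m (leqnn _).
have h d : t < t_ (- m%:Z + d%:Z) -> exists i, t_ i <= t < t_ (i + 1).
  elim: d => [|d IH]; first by rewrite addr0 ltNge mt.
  have -> : - m%:Z + d.+1%:Z = - m%:Z + d%:Z + 1 by lia.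
  move=> td; have [/IH//|dt] := ltP t (t_ (- m%:Z + d%:Z)).
  by exists (- m%:Z + d%:Z); rewrite dt td.
by apply: (h (m + p)%N); have -> : - m%:Z + (m + p)%:Z = p%:Z by lia.
Qed.

Definition cell t : int := projT1 (cid (cell_exists t)).

Lemma cellP t : t_ (cell t) <= t < t_ (cell t + 1).
Proof. exact: projT2 (cid (cell_exists t)). Qed.

Lemma cell_uniq t k : t_ k <= t < t_ (k + 1) -> cell t = k.
Proof.
move=> /andP[k1 k2]; have /andP[c1 c2] := cellP t.
apply/eqP; rewrite eq_le !leNgt; apply/andP; split; apply/negP => h.
  have : t_ (k + 1) <= t_ (cell t) by apply: node_le; lia.
  lra.
have : t_ (cell t + 1) <= t_ k by apply: node_le; lia.
lra.
Qed.

End cells.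

(** * Gluing and superposing solutions cell by cell *)

Section glue.
Variables (R : realType) (n : nat) (t_ zeta : int -> R) (theta : R).
Hypothesis hseq : pca_seqs t_ zeta theta.
Implicit Types (G : int -> R -> 'cV[R]_n -> 'cV[R]_n -> 'cV[R]_n)
  (u : R -> 'cV[R]_n).

(* On the cell [k] the right-hand side is [G k]; the value of the deviated
   argument is [zeta k]. *)
Definition cell_solution G u : Prop :=
  continuous u /\ forall k t, t_ k < t < t_ (k + 1) ->
    is_derive t (1 : R) u (G k t (u t) (u (zeta k))).

(** Only continuity at a node is at issue; there the pieces of the two adjacent cells agree, and
    each controls one side. *)
Lemma glue_cells G (U : int -> R -> 'cV[R]_n) :
  (forall k, continuous (U k)) ->
  (forall k t, t_ k < t < t_ (k + 1) ->
    is_derive t (1 : R) (U k) (G k t (U k t) (U k (zeta k)))) ->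
  (forall k, U k (t_ (k + 1)) = U (k + 1) (t_ (k + 1))) ->
  exists u, cell_solution G u /\
    forall k t, t_ k <= t <= t_ (k + 1) -> u t = U k t.
Proof.
move=> cU dU match_.
pose u t := U (cell hseq t) t.
have uE k t : t_ k <= t <= t_ (k + 1) -> u t = U k t.
  move=> /andP[kt]; rewrite le_eqVlt => /predU1P[->|tk].
    rewrite /u (@cell_uniq _ _ _ _ hseq _ (k + 1)) ?match_//.
    by rewrite lexx/= (node_lt hseq)//; lia.
  by rewrite /u (@cell_uniq _ _ _ _ hseq _ k) ?kt.
exists u; split=> //; split=> [x|k t tk].
- set k := cell hseq x; have /andP[kx xk] := cellP hseq x.
  apply/cvgrPdist_lt => e e0.
  have right : \forall s \near x, t_ k <= s -> `|u x - u s| < e.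
    have /cvgrPdist_lt/(_ _ e0) := cU k x.
    apply: filterS2 (lt_nbhsl xk) => s sk1 h sk.
    by rewrite (uE k x) ?(uE k s)// ?kx ?sk/= ltW.
  have [kx'|xk'] := ltP (t_ k) x.
    by apply: filterS2 (lt_nbhsr kx') right => s /ltW + h; exact: h.
  have ex : x = t_ k by apply/eqP; rewrite eq_le xk' kx.
  have left : \forall s \near x, s <= t_ k -> `|u x - u s| < e.
    have /cvgrPdist_lt/(_ _ e0) := cU (k - 1) x.
    have lx : t_ (k - 1) < x by rewrite ex (node_lt hseq)//; lia.
    apply: filterS2 (lt_nbhsr lx) => s sk1 h sk.
    by rewrite (uE (k - 1) x) ?(uE (k - 1) s)// subrK ?ex ?sk ?lexx ?andbT// ltW// -ex.
  apply: filterS2 left right => s h1 h2.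
  by have [/h2|/ltW/h1] := leP (t_ k) s.
- rewrite !(uE k); last 2 first.
  + exact: zeta_in hseq k.
  + by case/andP: tk => *; rewrite !ltW.
  apply: near_eq_is_derive (dU k t tk).
  have /andP[k1 k2] := tk.
  apply: filterS2 (lt_nbhsr k1) (lt_nbhsl k2) => s s1 s2.
  by rewrite (uE k)// !ltW.
Qed.

(** Superposition, stated for arbitrary right-hand sides so that linear, forced and perturbed
    solutions can all be subtracted from one another. *)
Lemma cell_solution_sub G1 G2 G u1 u2 :
  (forall k t, G k t (u1 t - u2 t) (u1 (zeta k) - u2 (zeta k)) =
     G1 k t (u1 t) (u1 (zeta k)) - G2 k t (u2 t) (u2 (zeta k))) ->
  cell_solution G1 u1 -> cell_solution G2 u2 ->
  cell_solution G (fun t => u1 t - u2 t).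
Proof.
move=> hG [c1 d1] [c2 d2]; split; first exact: continuous_sub.
move=> k t tk; rewrite hG.
exact: is_derive_sub (d1 k t tk) (d2 k t tk).
Qed.

Lemma cell_solution_add G1 G2 G u1 u2 :
  (forall k t, G k t (u1 t + u2 t) (u1 (zeta k) + u2 (zeta k)) =
     G1 k t (u1 t) (u1 (zeta k)) + G2 k t (u2 t) (u2 (zeta k))) ->
  cell_solution G1 u1 -> cell_solution G2 u2 ->
  cell_solution G (fun t => u1 t + u2 t).
Proof.
move=> hG [c1 d1] [c2 d2]; split; first exact: continuous_add.
move=> k t tk; rewrite hG.
exact: is_derive_add (d1 k t tk) (d2 k t tk).
Qed.

End glue.

Lemma absz_between (x y z c : int) :
  x <= z -> z <= y -> (`|z - c| <= `|x - c| + `|y - c|)%N.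
Proof. lia. Qed.

Lemma absz_sub_eq0 (k c : int) : (`|k - c| <= 0)%N -> k = c.
Proof. lia. Qed.

Lemma absz_succ_le (k c : int) (m : nat) :
  (`|k - c| <= m.+1)%N -> k < c -> (`|(k + 1)%R - c| <= m)%N.
Proof. lia. Qed.

Lemma absz_pred_le (k c : int) (m : nat) :
  (`|k - c| <= m.+1)%N -> c <= k -> k != c -> (`|(k - 1)%R - c| <= m)%N.
Proof. lia. Qed.

(** * Existence, uniqueness and growth of solutions *)

Section cauchy_problem.
Variables (R : realType) (n : nat) (N : 'cV[R]_n -> R).
Hypothesis hN : is_norm N.
Variables (t_ zeta : int -> R) (theta : R).
Hypothesis hseq : pca_seqs t_ zeta theta.
Variables (a b : R).
Hypotheses (a0 : 0 < a) (b0 : 0 < b) (theta0 : 0 < theta).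
Hypothesis smallness : b * ((expR (a * theta) - 1) / a) < 1.
Implicit Types (G : int -> R -> 'cV[R]_n -> 'cV[R]_n -> 'cV[R]_n)
  (u w : R -> 'cV[R]_n).

(** The class of right-hand sides treated uniformly: the linear, forced and perturbed equations
    belong to it with the same [a] and [b]. The bound at zero starts the Picard iteration. *)
Definition admissible G : Prop :=
  [/\ forall k u y, continuous u -> continuous (fun t => G k t (u t) y),
      forall k t x x' y y',
        N (G k t x y - G k t x' y') <= a * N (x - x') + b * N (y - y')
    & exists m, forall k t, N (G k t 0 0) <= m].

Lemma cell_ivp G k tau xi : admissible G -> t_ k <= tau <= t_ (k + 1) ->
  exists2 u : R -> 'cV[R]_n, forall t, is_derive t (1 : R) u (G k t (u t) (u (zeta k))) & u tau = xi.
Proof.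
move=> [cG lG [m mG]] hk.
apply: (frozen_ivp hN a0 b0 theta0 smallness xi (cG k) (lG k) (mG k)).
have := zeta_in hseq k; have := node_step hseq k.
rewrite ler_norml; lra.
Qed.

Lemma cell_solution_exists G tau xi : admissible G ->
  exists2 u, cell_solution t_ zeta G u & u tau = xi.
Proof.
move=> aG; pose k0 := cell hseq tau.
have k0P := cellP hseq tau.
have k0P' : t_ k0 <= tau <= t_ (k0 + 1).
  by case/andP: k0P => -> /ltW ->.
have [x0 dx0 x0tau] := cell_ivp xi aG k0P'.
pose S k (u : R -> 'cV[R]_n) :=
  forall t, is_derive t (1 : R) u (G k t (u t) (u (zeta k))).
have [||U [U0 hU]] := @int_chain _ S (fun k u v => u (t_ (k + 1)) = v (t_ (k + 1))) k0 x0 dx0.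
- move=> k x _; have [|y dy ye] := @cell_ivp G (k + 1) (t_ (k + 1)) (x (t_ (k + 1))) aG.
    by rewrite lexx/= ltW// (node_lt hseq)// ltzD1.
  by exists y.
- move=> k y _; have [|x dx xe] := @cell_ivp G k (t_ (k + 1)) (y (t_ (k + 1))) aG.
    by rewrite lexx andbT ltW// (node_lt hseq)// ltzD1.
  by exists x.
have cU k : continuous (U k).
  by have [dU _] := hU k; move=> t; exact: is_derive_continuous (dU t).
have [u [su uE]] : exists u, cell_solution t_ zeta G u /\
    forall k t, t_ k <= t <= t_ (k + 1) -> u t = U k t.
  apply: (glue_cells hseq cU) => [k t _|k]; first by have [dU _] := hU k.
  by have [_] := hU k.
by exists u; rewrite // (uE k0)// U0.
Qed.

(** What the difference of two solutions of one admissible equation retains, and all that growth and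
    uniqueness need. *)
Definition difference_inequality w : Prop :=
  continuous w /\ exists w' : int -> R -> 'cV[R]_n, forall k t, t_ k < t < t_ (k + 1) ->
    is_derive t (1 : R) w (w' k t) /\ N (w' k t) <= a * N (w t) + b * N (w (zeta k)).

Lemma difference_inequality_sub G u1 u2 : admissible G ->
  cell_solution t_ zeta G u1 -> cell_solution t_ zeta G u2 ->
  difference_inequality (fun t => u1 t - u2 t).
Proof.
move=> [_ lG _] [c1 d1] [c2 d2]; split; first exact: continuous_sub.
exists (fun k t => G k t (u1 t) (u1 (zeta k)) - G k t (u2 t) (u2 (zeta k))).
move=> k t tk; split; last exact: lG.
exact: is_derive_sub (d1 k t tk) (d2 k t tk).
Qed.

(** The summand 1 makes the powers of [D] increase with the number of cells crossed. *)
Let D := 1 + growth a b theta.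

Let D0 : 0 < D.
Proof. by rewrite addr_gt0// growth_gt0. Qed.

Let cell_growth w k s t : difference_inequality w ->
  t_ k <= s <= t_ (k + 1) -> t_ k <= t <= t_ (k + 1) -> N (w t) <= D * N (w s).
Proof.
move=> [cw [w' hw]] hs ht.
apply: (@le_trans _ _ (growth a b theta * N (w s))); last first.
  by rewrite ler_wpM2r ?norm_ge0// lerDr.
apply: (frozen_growth (w' := w' k) hN a0 b0 theta0 smallness (node_step hseq k)
  (zeta_in hseq k) cw _ _ hs ht) => [x hx|x hx].
- by have [] := hw k x hx.
- by have [] := hw k x hx.
Qed.

Let node_in k : t_ k <= t_ k <= t_ (k + 1).
Proof. by rewrite lexx ltW// (node_lt hseq)// ltzD1. Qed.

Let node_in' k : t_ k <= t_ (k + 1) <= t_ (k + 1).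
Proof. by rewrite lexx andbT ltW// (node_lt hseq)// ltzD1. Qed.

Let cells_growth w tau : difference_inequality w ->
  forall (m : nat) k, (`|k - cell hseq tau| <= m)%N ->
  forall t, t_ k <= t <= t_ (k + 1) -> N (w t) <= D ^+ m.+1 * N (w tau).
Proof.
move=> hw; have hc : t_ (cell hseq tau) <= tau <= t_ (cell hseq tau + 1).
  by have /andP[-> /ltW ->] := cellP hseq tau.
set c := cell hseq tau.
elim=> [|m IH] k hk t ht.
  have kc : k = c by exact: absz_sub_eq0.
  by rewrite expr1; apply: cell_growth hw _ ht; rewrite kc.
have base s : t_ k <= s <= t_ (k + 1) -> N (w s) <= D ^+ m.+1 * N (w tau) ->
    N (w t) <= D ^+ m.+2 * N (w tau).
  move=> hs hb; rewrite (le_trans (cell_growth hw hs ht))// exprS -mulrA.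
  by rewrite ler_wpM2l// ltW.
have [kc|ck] := ltP k c.
  by apply: base (node_in' k) _; apply: (IH (k + 1)) (node_in _); exact: absz_succ_le.
have [kc|kc] := eqVneq k c.
  rewrite (le_trans (IH k _ t ht))//; first by rewrite kc subrr.
  by rewrite ler_wpM2r ?norm_ge0// [leRHS]exprS ler_peMl ?exprn_ge0 ?(ltW D0)// lerDl
    ltW// growth_gt0.
have := node_in' (k - 1); rewrite subrK => h.
apply: base (node_in k) _; apply: (IH (k - 1)); first exact: absz_pred_le.
by rewrite subrK.
Qed.

Lemma window_growth tau T : exists2 C, 0 < C &
  forall w, difference_inequality w ->
  forall t, `|t - tau| <= T -> N (w t) <= C * N (w tau).
Proof.
pose c := cell hseq tau.
pose m := (`|cell hseq (tau - T)%R - c| + `|cell hseq (tau + T)%R - c|)%N.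
exists (D ^+ m.+1) => [|w hw t ht]; first exact: exprn_gt0.
have /andP[t1 t2] := cellP hseq t.
apply: (cells_growth hw (k := cell hseq t)); last by rewrite t1 ltW.
have /andP[p1 p2] := cellP hseq (tau + T).
have /andP[m1 m2] := cellP hseq (tau - T).
have h1 : cell hseq t <= cell hseq (tau + T).
  rewrite leNgt; apply/negP => h.
  have : t_ (cell hseq (tau + T) + 1) <= t_ (cell hseq t) by rewrite (node_le hseq)// lezD1.
  move: ht; rewrite ler_norml; lra.
have h2 : cell hseq (tau - T) <= cell hseq t.
  rewrite leNgt; apply/negP => h.
  have : t_ (cell hseq t + 1) <= t_ (cell hseq (tau - T)) by rewrite (node_le hseq)// lezD1.
  move: ht; rewrite ler_norml; lra.
exact: absz_between.
Qed.

Lemma difference_eq0 w tau : difference_inequality w -> w tau = 0 -> forall t, w t = 0.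
Proof.
move=> hw w0 t; have [C _ hC] := window_growth tau `|t - tau|.
apply: (norm_eq0 hN); apply/eqP; rewrite eq_le norm_ge0// andbT.
by have := hC w hw t (lexx _); rewrite w0 norm0// mulr0.
Qed.

Lemma cell_solution_uniq G u1 u2 tau : admissible G ->
  cell_solution t_ zeta G u1 -> cell_solution t_ zeta G u2 ->
  u1 tau = u2 tau -> u1 = u2.
Proof.
move=> aG s1 s2 e; apply/funext => t; apply/eqP; rewrite -subr_eq0; apply/eqP.
apply: (difference_eq0 (difference_inequality_sub aG s1 s2) (tau := tau)).
by rewrite e subrr.
Qed.

(** On a closed cell a solution coincides with a function differentiable on the whole line, which
    supplies the one-sided derivatives at the nodes. *)
Lemma cell_solution_extends G u k s : admissible G -> cell_solution t_ zeta G u ->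
  t_ k <= s <= t_ (k + 1) ->
  exists2 x : R -> 'cV[R]_n, forall t, is_derive t (1 : R) x (G k t (x t) (x (zeta k))) &
    forall t, t_ k <= t <= t_ (k + 1) -> u t = x t.
Proof.
move=> aG [cu du] hs; have [x dx xs] := cell_ivp (u s) aG hs.
exists x => // t ht; apply/eqP; rewrite -subr_eq0; apply/eqP.
apply: (norm_eq0 hN); apply/eqP; rewrite eq_le norm_ge0// andbT.
have [_ lG _] := aG.
have dw r : t_ k < r < t_ (k + 1) ->
    is_derive r (1 : R) (fun r => u r - x r)
      (G k r (u r) (u (zeta k)) - G k r (x r) (x (zeta k))).
  by move=> hr; exact: is_derive_sub (du k r hr) (dx r).
have := frozen_growth hN a0 b0 theta0 smallness (node_step hseq k) (zeta_in hseq k)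
  (continuous_sub cu (fun r => is_derive_continuous (dx r))) dw
  (fun r _ => lG _ _ _ _ _ _) hs ht.
by rewrite xs subrr norm0// mulr0.
Qed.

Variable gamma : R -> R.
Hypothesis hgamma : pca_arg t_ zeta gamma.

(** The clauses at the nodes are automatic: at t_i the right derivative comes from the extension of
    cell i, the left one from cell i - 1, whose deviated argument is still zeta (i - 1). *)
Lemma is_solutionP (g : R -> 'cV[R]_n -> 'cV[R]_n -> 'cV[R]_n) u :
  admissible (fun=> g) ->
  is_solution t_ gamma g u <-> cell_solution t_ zeta (fun=> g) u.
Proof.
move=> ag; split=> [[cu du _ _]|su].
  split=> // k t tk; rewrite -(hgamma (i := k) (t := t)); first exact: (du k).
  by case/andP: tk => tk1 tk2; rewrite (ltW tk1).
have [cu du] := su; split=> // [i t ti|i|i].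
- rewrite (hgamma (i := i)); first exact: du ti.
  by case/andP: ti => ti1 ti2; rewrite (ltW ti1).
- have [x dx ux] := cell_solution_extends ag su (node_in i).
  have step : t_ i < t_ (i + 1) by rewrite (node_lt hseq)// ltzD1.
  rewrite (hgamma (i := i)) ?lexx// ux// (ux (zeta i)) ?(zeta_in hseq)//.
  have /is_derive_cvgP/cvg_dnbhs_at_right := dx (t_ i).
  apply: cvg_trans; apply: near_eq_cvg.
  have d0 : 0 < t_ (i + 1) - t_ i by rewrite subr_gt0.
  apply: filterS2 (nbhs_right_gt (0 : R)) (nbhs_right_lt d0) => h h0 hd.
  by rewrite (ux (h + t_ i))//; apply/andP; split; lra.
- have [|x dx ux] := cell_solution_extends (k := i - 1) (s := t_ i) ag su.
    by have := node_in' (i - 1); rewrite subrK.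
  have step : t_ (i - 1) < t_ i by rewrite (node_lt hseq)// gtrBl.
  apply/cvg_ex; exists (g (t_ i) (x (t_ i)) (x (zeta (i - 1)))).
  have /is_derive_cvgP/cvg_dnbhs_at_left := dx (t_ i).
  apply: cvg_trans; apply: near_eq_cvg.
  have d0 : t_ (i - 1) - t_ i < 0 by rewrite subr_lt0.
  rewrite subrK in ux.
  apply: filterS2 (nbhs_left_lt (0 : R)) (nbhs_left_gt d0) => h h0 hd.
  rewrite (ux (h + t_ i)) ?(ux (t_ i))// ?lexx ?(ltW step)//.
  by apply/andP; split; lra.
Qed.

End cauchy_problem.

(** * The discrete convolution kernel *)

Section kernel_sum.
Variable R : realType.

(** This is 2 sinh x >= 2 x; the derivative of the difference is a perfect square. *)
Lemma expR_sym_ge (x : R) : 0 <= x -> 2 * x <= expR x - expR (- x).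
Proof.
move=> x0; rewrite -subr_ge0.
pose g (h : R) := expR (1 * (h - 0)) - expR ((- 1) * (h - 0)) - 2 * h.
pose g' (h : R) := 1 * expR (1 * (h - 0)) - (- 1) * expR ((- 1) * (h - 0)) - 2 * 1.
have dg h : is_derive h (1 : R) g (g' h).
  exact: (is_derive_sub (is_derive_sub (is_derive_exp_scale 1 0 h)
    (is_derive_exp_scale (- 1) 0 h)) (is_derive_scale 2 (is_derive_id h (1 : R)))).
have g'0 h : 0 <= g' h.
  have -> : g' h = (expR (h / 2) - expR (- (h / 2))) ^+ 2.
    have e1 : expR (1 * (h - 0)) = expR (h / 2) * expR (h / 2).
      by rewrite -expRD; congr expR; lra.
    have e2 : expR (- 1 * (h - 0)) = expR (- (h / 2)) * expR (- (h / 2)).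
      by rewrite -expRD; congr expR; lra.
    have e3 : expR (h / 2) * expR (- (h / 2)) = 1 by rewrite -expRD subrr expR0.
    by rewrite /g' e1 e2; lra.
  exact: sqr_ge0.
have := nondecreasing_of_derive_ge0 dg g'0 x0.
rewrite /g !subr0 !mulr0 expR0 subrr subr0 mul1r mulN1r; lra.
Qed.

(** Factoring exp(- alpha d / 2) out of 1 - exp(- alpha d) leaves 2 sinh(alpha d / 2) >= alpha d, so
    that only half of the exponent alpha theta is lost. *)
Lemma exp_chord (alpha theta d : R) : 0 < alpha -> 0 <= d <= theta ->
  d <= expR (alpha * theta / 2) / alpha * (1 - expR (- (alpha * d))).
Proof.
move=> a0 /andP[d0 dth].
rewrite mulrAC ler_pdivlMr//.
have x0 : 0 <= d * alpha by rewrite mulr_ge0// ltW.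
have h : d * alpha <= expR (d * alpha / 2) * (1 - expR (- (alpha * d))).
  rewrite mulrBr mulr1 -expRD.
  have -> : d * alpha / 2 + - (alpha * d) = - (d * alpha / 2) by lra.
  by apply: le_trans (expR_sym_ge _); [lra|rewrite divr_ge0].
apply: le_trans h _; apply: ler_wpM2r.
  by rewrite subr_ge0 -expR0 ler_expR oppr_le0 mulrC.
by rewrite ler_expR ler_wpM2r ?invr_ge0// mulrC ler_wpM2l// ltW.
Qed.

(** The balance on the cell containing t, with lengths scaled by alpha: u = alpha theta / 2, [p] and
    [q] are the distances from t to the two nodes, and [a] is the distance to zeta_k, which lies on
    the side of [p]. Equality holds at u = 0, so no constant can be spared. *)
Lemma exp_cell_bound (u p q a : R) :
  0 <= a -> a <= p -> 0 <= q -> p + q <= 2 * u ->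
  a + expR (- p) * (expR u + (p - a)) + expR (- q) * (expR u + (q + a)) <=
  2 * expR (2 * u).
Proof.
move=> a0 ap q0 pq.
have u0 : 0 <= u by lra.
set y := expR u.
have y1 : 1 + u <= y by exact: expR_ge1Dx.
have yy : expR (2 * u) = y * y by rewrite -expRD; congr expR; lra.
have p1 : expR (- p) <= 1 by rewrite -expR0 ler_expR; lra.
have s1 : expR (- q) * (y + (q + a)) <= y + a.
  rewrite expRN mulrC ler_pdivrMr ?expR_gt0//.
  have h : 1 + q <= expR q by exact: expR_ge1Dx.
  have : (y + a) * (1 + q) <= (y + a) * expR q by rewrite ler_wpM2l//; lra.
  have : 0 <= (y + a - 1) * q by rewrite mulr_ge0//; lra.
  lra.
have s2 : 0 <= (p - a) * (2 - expR (- p)) by rewrite mulr_ge0//; lra.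
suff s3 : y + 2 * p + expR (- p) * y <= 2 * (y * y) by rewrite yy; lra.
have [y2|y2] := leP 2 y.
  have h1 : expR (- p) * y <= y by rewrite ler_piMl//; lra.
  have : 0 <= (y - 2) * (y - 1) by rewrite mulr_ge0//; lra.
  lra.
have y0 : 0 < y by exact: expR_gt0.
(* With p = 2 u - d the left side is y + 4 u - 2 d + exp(d) / y, and y < 2 yields exp(d) / y - 2 d
   <= 1 / y. *)
pose d := 2 * u - p.
have d0 : 0 <= d by rewrite /d; lra.
have e1 : expR (- p) * y = expR d / y.
  rewrite /d expRD yy; field; exact: lt0r_neq0.
have e2 : expR d - 1 <= d * (y * y).
  have h1 : expR d <= y * y by rewrite -yy ler_expR /d; lra.
  have h2 : 1 - d <= expR (- d) by exact: expR_ge1Dx.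
  have h3 : (1 - d) * expR d <= expR (- d) * expR d by rewrite ler_wpM2r// expR_ge0.
  rewrite -expRD addNr expR0 in h3.
  have h4 : d * expR d <= d * (y * y) by rewrite ler_wpM2l.
  lra.
have e3 : expR d / y <= 1 / y + 2 * d.
  rewrite ler_pdivrMr// mulrDl mul1r mulVf ?gt_eqF//.
  have : d * y * y <= d * y * 2 by rewrite ler_wpM2l ?mulr_ge0// ltW.
  lra.
have e4 : y + 1 / y + 4 * (y - 1) <= 2 * (y * y).
  rewrite -subr_ge0.
  have -> : 2 * (y * y) - (y + 1 / y + 4 * (y - 1)) = (y - 1) ^+ 2 * (2 * y - 1) / y.
    by field; exact: lt0r_neq0.
  by rewrite divr_ge0 ?(ltW y0)// mulr_ge0 ?sqr_ge0//; lra.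
rewrite e1; move: e3 e4; rewrite /d; lra.
Qed.

Variables (t_ zeta : int -> R) (theta : R).
Hypothesis hseq : pca_seqs t_ zeta theta.

Definition kernel_weight (alpha t : R) (r : int) : R :=
  expR (- alpha * `|t - t_ r|) * (zeta r - zeta (r - 1)).

Lemma zeta_ge k : t_ k <= zeta k.
Proof. by have /andP[] := zeta_in hseq k. Qed.

Lemma zeta_le k : zeta k <= t_ (k + 1).
Proof. by have /andP[] := zeta_in hseq k. Qed.

Lemma zeta_pred_le k : zeta (k - 1) <= t_ k.
Proof. by have := zeta_le (k - 1); rewrite subrK. Qed.

Lemma kernel_weight_ge0 alpha t r : 0 <= kernel_weight alpha t r.
Proof.
rewrite mulr_ge0 ?expR_ge0// subr_ge0.
exact: le_trans (zeta_pred_le r) (zeta_ge r).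
Qed.

(* Each weight is bounded by the increment of a nondecreasing potential, so
   that the sum telescopes. *)
Lemma kernel_sum_le (alpha t : R) (k : int) : 0 < alpha ->
  t_ k <= t <= t_ (k + 1) -> forall m,
  `|t - zeta k| + \sum_(0 <= i < m)
    (kernel_weight alpha t (Posz i) + kernel_weight alpha t (Negz i)) <=
  2 * expR (alpha * theta) / alpha.
Proof.
move=> a0 /andP[kt tk] m.
set y := expR (alpha * theta / 2).
have y0 : 0 < y by exact: expR_gt0.
have ya0 : 0 < y / alpha by rewrite divr_gt0.
have chord d : 0 <= d <= theta -> d <= y / alpha * (1 - expR (- (alpha * d))).
  exact: exp_chord.
have chord' d : 0 <= d <= theta -> d <= y / alpha * (expR (alpha * d) - 1).
  move=> hd; apply: le_trans (chord d hd) _; rewrite ler_wpM2l ?(ltW ya0)//.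
  have : 1 + alpha * d <= expR (alpha * d) by exact: expR_ge1Dx.
  have : 1 + - (alpha * d) <= expR (- (alpha * d)) by exact: expR_ge1Dx.
  lra.
have len r : 0 <= t_ r - zeta (r - 1) <= theta /\ 0 <= zeta r - t_ r <= theta.
  have h1 := zeta_pred_le r; have h2 := zeta_ge r; have h3 := zeta_ge (r - 1).
  have h4 := zeta_le r; have h5 := node_step hseq r; have h6 := node_step hseq (r - 1).
  rewrite subrK in h6; split; lra.
(* [top_left] bounds the total weight of the nodes with r <= k, [right_] that of the others. The
   term y / alpha is what the far nodes telescope to; the added length is the part of cell [k]
   between the node and zeta k. *)
pose top_left := expR (- (alpha * (t - t_ k))) * (y / alpha + (zeta k - t_ k)).
pose right_ := expR (- (alpha * (t_ (k + 1) - t))) *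
  (y / alpha + (t_ (k + 1) - zeta k)).
pose pot (r : int) := if r < k then y / alpha * expR (- (alpha * (t - zeta r)))
  else if r == k then top_left
  else top_left + right_ - y / alpha * expR (- (alpha * (zeta r - t))).
have tl0 : 0 <= top_left.
  by rewrite mulr_ge0 ?expR_ge0// addr_ge0 ?(ltW ya0)// subr_ge0 zeta_ge.
have r0 : 0 <= right_.
  by rewrite mulr_ge0 ?expR_ge0// addr_ge0 ?(ltW ya0)// subr_ge0 zeta_le.
(* The mass zeta r - zeta (r - 1) is split at t_r. Each half is bounded by an exponential increment,
   except the halves lying in cell [k], which [pot] contains as they stand. *)
have step r : kernel_weight alpha t r <= pot r - pot (r - 1).
  rewrite /kernel_weight /pot.
  have [l1 l2] := len r.
  have c1 := chord _ l1; have c2 := chord' _ l1.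
  have c3 := chord _ l2; have c4 := chord' _ l2.
  pose c := y / alpha; rewrite -/c in c1 c2 c3 c4 *.
  pose X := expR (alpha * (zeta r - t_ r)).
  pose Y := expR (- (alpha * (t_ r - zeta (r - 1)))).
  pose X' := expR (alpha * (t_ r - zeta (r - 1))).
  pose Y' := expR (- (alpha * (zeta r - t_ r))).
  rewrite -/X -/Y -/X' -/Y' in c1 c2 c3 c4.
  set E := expR (- alpha * _); have E0 : 0 <= E by exact: expR_ge0.
  have [rk|kr|rk] := ltgtP r k.
  - have rk' : r - 1 < k by rewrite (lt_trans _ rk)// gtrBl.
    have tr : t_ r <= t by rewrite (le_trans _ kt)// (node_le hseq) ?ltW.
    have EE : E = expR (- (alpha * (t - t_ r))) by rewrite /E mulNr ger0_norm ?subr_ge0.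
    rewrite rk'.
    have -> : expR (- (alpha * (t - zeta r))) = E * X.
      by rewrite EE /X -expRD; congr expR; lra.
    have -> : expR (- (alpha * (t - zeta (r - 1)))) = E * Y.
      by rewrite EE /Y -expRD; congr expR; lra.
    have := ler_wpM2l E0 (lerD c1 c4); lra.
  - have -> : (r - 1 < k) = false by apply/negbTE; rewrite -leNgt lerBrDr lezD1.
    have tr : t <= t_ r by rewrite (le_trans tk)// (node_le hseq)// lezD1.
    have EE : E = expR (- (alpha * (t_ r - t))).
      by rewrite /E mulNr distrC ger0_norm ?subr_ge0.
    have -> : expR (- (alpha * (zeta r - t))) = E * Y'.
      by rewrite EE /Y' -expRD; congr expR; lra.
    have [rk|rk] := eqVneq (r - 1) k.
      have rk1 : k + 1 = r by rewrite -rk subrK.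
      rewrite /right_ rk1 -rk -EE -/c.
      have := ler_wpM2l E0 c3; lra.
    have -> : expR (- (alpha * (zeta (r - 1) - t))) = E * X'.
      by rewrite EE /X' -expRD; congr expR; lra.
    have := ler_wpM2l E0 (lerD c2 c3); lra.
  - have tr : t_ r <= t by rewrite rk.
    have EE : E = expR (- (alpha * (t - t_ r))) by rewrite /E mulNr ger0_norm ?subr_ge0.
    rewrite -rk gtrBl ltr01 /top_left -rk -EE -/c.
    have -> : expR (- (alpha * (t - zeta (r - 1)))) = E * Y.
      by rewrite EE /Y -expRD; congr expR; lra.
    have := ler_wpM2l E0 c1; lra.
(* Pairing [Posz i] with [Negz i] = -(i + 1) makes the sum run over -j <= r < j. *)
have tele j : \sum_(0 <= i < j)
    (kernel_weight alpha t (Posz i) + kernel_weight alpha t (Negz i)) <=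
    pot (j%:Z - 1) - pot (- j%:Z - 1).
  elim: j => [|j IH]; first by rewrite big_nil oppr0 subrr.
  rewrite big_nat_recr//=.
  have s1 := step (Posz j); have s2 := step (Negz j).
  have -> : j.+1%:Z - 1 = j%:Z by rewrite -addn1 PoszD addrK.
  have -> : - j.+1%:Z - 1 = Negz j - 1 by rewrite NegzE.
  have e : Negz j = - j%:Z - 1 by rewrite NegzE -addn1 PoszD opprD.
  rewrite e in s2 *; lra.
have pot_bounds r : 0 <= pot r /\ pot r <= top_left + right_.
  rewrite /pot; have [rk|kr|rk] := ltgtP r k.
  - split; first by rewrite mulr_ge0 ?expR_ge0// ltW.
    have h1 : expR (- (alpha * (t - zeta r))) <= expR (- (alpha * (t - t_ k))).
      rewrite ler_expR lerN2 ler_wpM2l ?(ltW a0)// lerB//.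
      by rewrite (le_trans (zeta_le r))// (node_le hseq)// lezD1.
    have h2 : 0 <= expR (- (alpha * (t - t_ k))) * (zeta k - t_ k).
      by rewrite mulr_ge0 ?expR_ge0// subr_ge0 zeta_ge.
    have := ler_wpM2l (ltW ya0) h1; rewrite /top_left; lra.
  - split; last by rewrite gerBl mulr_ge0 ?expR_ge0// ltW.
    have h1 : expR (- (alpha * (zeta r - t))) <= expR (- (alpha * (t_ (k + 1) - t))).
      rewrite ler_expR lerN2 ler_wpM2l ?(ltW a0)// lerB//.
      by rewrite (le_trans _ (zeta_ge r))// (node_le hseq)// lezD1.
    have h2 : 0 <= expR (- (alpha * (t_ (k + 1) - t))) * (t_ (k + 1) - zeta k).
      by rewrite mulr_ge0 ?expR_ge0// subr_ge0 zeta_le.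
    have := ler_wpM2l (ltW ya0) h1; rewrite /right_; lra.
  - by split=> //; rewrite lerDl.
have sum_le : \sum_(0 <= i < m)
    (kernel_weight alpha t (Posz i) + kernel_weight alpha t (Negz i)) <=
    top_left + right_.
  have [_ h1] := pot_bounds (m%:Z - 1); have [h2 _] := pot_bounds (- m%:Z - 1).
  have := tele m; lra.
apply: le_trans (lerD (lexx _) sum_le) _.
rewrite ler_pdivlMr//.
have [h1 h2 h3] : [/\ zeta k <= t_ (k + 1), t_ k <= zeta k & t_ (k + 1) - t_ k <= theta].
  by rewrite zeta_le zeta_ge (node_step hseq).
have h4 : alpha * (t_ (k + 1) - t_ k) <= alpha * theta by rewrite ler_wpM2l// ltW.
have al x : x <= 0 -> alpha * x <= 0 by move=> x0; rewrite mulr_ge0_le0// ltW.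
have e1 : top_left * alpha = expR (- (alpha * (t - t_ k))) * (y + alpha * (zeta k - t_ k)).
  by rewrite /top_left; field; exact: lt0r_neq0.
have e2 : right_ * alpha =
    expR (- (alpha * (t_ (k + 1) - t))) * (y + alpha * (t_ (k + 1) - zeta k)).
  by rewrite /right_; field; exact: lt0r_neq0.
rewrite mulrDl mulrDl e1 e2.
have -> : alpha * theta = 2 * (alpha * theta / 2) by lra.
(* In both cases [p] is the distance from [t] to the node on the side of zeta k, so the roles of the
   two nodes are exchanged. *)
have [zt|tz] := leP (zeta k) t.
  rewrite ger0_norm ?subr_ge0//.
  have := @exp_cell_bound (alpha * theta / 2) (alpha * (t - t_ k))
    (alpha * (t_ (k + 1) - t)) (alpha * (t - zeta k)).
  rewrite -mulrBr -!mulrDr -/y.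
  have -> : t - t_ k - (t - zeta k) = zeta k - t_ k by lra.
  have -> : t_ (k + 1) - t + (t - zeta k) = t_ (k + 1) - zeta k by lra.
  move=> H; rewrite addrA mulrC; apply: H.
  - by rewrite mulr_ge0 ?(ltW a0)// subr_ge0.
  - by rewrite ler_wpM2l ?(ltW a0)// lerB.
  - by rewrite mulr_ge0 ?(ltW a0)// subr_ge0.
  - lra.
rewrite ltr0_norm ?subr_lt0// opprB.
have := @exp_cell_bound (alpha * theta / 2) (alpha * (t_ (k + 1) - t))
  (alpha * (t - t_ k)) (alpha * (zeta k - t)).
rewrite -mulrBr -!mulrDr -/y.
have -> : t_ (k + 1) - t - (zeta k - t) = t_ (k + 1) - zeta k by lra.
have -> : t - t_ k + (zeta k - t) = zeta k - t_ k by lra.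
move=> H; rewrite [X in _ + X]addrC addrA mulrC; apply: H.
- by rewrite mulr_ge0 ?(ltW a0)// subr_ge0 ltW.
- by rewrite ler_wpM2l ?(ltW a0)// lerB.
- by rewrite mulr_ge0 ?(ltW a0)// subr_ge0.
- lra.
Qed.

End kernel_sum.

(** * Linear systems and bounded solutions *)

Lemma continuous_mulmx (R : realType) (T : topologicalType) (n : nat)
    (A : T -> 'M[R]_n) (u : T -> 'cV[R]_n) :
  continuous A -> continuous u -> continuous (fun t => A t *m u t).
Proof.
move=> cA cu t; apply/cvgrPdist_lt => e e0.
pose B : R := n.+1%:R.
have B0 : 0 < B by rewrite ltr0n.
pose d := e / (2 * B * (`|A t| + `|u t| + 1)).
have S0 : 0 < `|A t| + `|u t| + 1 by rewrite ltr_wpDl// addr_ge0.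
have d0 : 0 < d by rewrite divr_gt0// !mulr_gt0.
have /cvgrPdist_lt h1 := cA t.
have /cvgrPdist_lt h2 := cu t.
apply: filterS3 (h1 _ ltr01) (h1 d d0) (h2 d d0) => s s1 s2 s3.
have -> : A t *m u t - A s *m u s = (A t - A s) *m u t + A s *m (u t - u s).
  by rewrite mulmxBl mulmxBr addrA subrK.
have bound (Q : 'M[R]_n) (x : 'cV[R]_n) : `|Q *m x| <= B * (`|Q| * `|x|).
  rewrite (le_trans (norm_mulmx Q x))// -mulrA ler_wpM2r ?mulr_ge0//.
  by rewrite ler_nat.
have As : `|A s| <= `|A t| + 1.
  have := ler_normD (A s - A t) (A t); rewrite subrK distrC; lra.
rewrite (le_lt_trans (ler_normD _ _))//.
rewrite (le_lt_trans (lerD (bound _ _) (bound _ _)))// -mulrDr.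
have m1 : `|A t - A s| * `|u t| <= d * `|u t| by rewrite ler_wpM2r// ltW.
have m2 : `|A s| * `|u t - u s| <= (`|A t| + 1) * d.
  by rewrite ler_pM// ltW.
apply: (@le_lt_trans _ _ (B * (d * (`|A t| + `|u t| + 1)))).
  by rewrite ler_wpM2l ?(ltW B0)//; lra.
have -> : B * (d * (`|A t| + `|u t| + 1)) = e / 2.
  by rewrite /d; field; rewrite !lt0r_neq0.
lra.
Qed.

Section linear_system.
Variables (R : realType) (n : nat) (N : 'cV[R]_n -> R).
Hypothesis hN : is_norm N.
Variables (t_ zeta : int -> R) (theta : R).
Hypothesis hseq : pca_seqs t_ zeta theta.
Variables (gamma : R -> R).
Hypothesis hgamma : pca_arg t_ zeta gamma.
Variables (a b : R).
Hypotheses (a0 : 0 < a) (b0 : 0 < b) (theta0 : 0 < theta).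
Hypothesis smallness : b * ((expR (a * theta) - 1) / a) < 1.
Variables (A A0 : R -> 'M[R]_n).
Hypotheses (cA : continuous A) (cA0 : continuous A0).
Hypotheses (Aa : forall t, opnorm N (A t) <= a) (A0b : forall t, opnorm N (A0 t) <= b).
Implicit Types (v : int -> R -> 'cV[R]_n) (u : R -> 'cV[R]_n).

(** The forcing is indexed by the cell because f (t, x t, x (zeta k)) changes its last argument from
    one cell to the next. *)
Definition forced_rhs v (k : int) t (x y : 'cV[R]_n) := lin_rhs A A0 t x y + v k t.

Notation lin_solution := (cell_solution t_ zeta (fun=> lin_rhs A A0)).

Lemma lin_rhs_lipschitz t x x' y y' :
  N (lin_rhs A A0 t x y - lin_rhs A A0 t x' y') <= a * N (x - x') + b * N (y - y').
Proof.
rewrite /lin_rhs opprD addrACA -!mulmxBr (le_trans (normD hN _ _))// lerD//.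
  by rewrite (le_trans (le_opnorm hN _ _))// ler_wpM2r ?norm_ge0.
by rewrite (le_trans (le_opnorm hN _ _))// ler_wpM2r ?norm_ge0.
Qed.

Lemma lin_rhs_continuous u y : continuous u ->
  continuous (fun t => lin_rhs A A0 t (u t) y).
Proof.
move=> cu; apply: continuous_add; first exact: continuous_mulmx.
by apply: continuous_mulmx => // t; exact: cst_continuous.
Qed.

Lemma admissible_forced v m : (forall k, continuous (v k)) ->
  (forall k t, N (v k t) <= m) -> admissible N a b (forced_rhs v).
Proof.
move=> cv vm; split=> [k u y cu|k t x x' y y'|].
- by apply: continuous_add => //; exact: lin_rhs_continuous.
- by rewrite /forced_rhs opprD addrACA subrr addr0; exact: lin_rhs_lipschitz.
- by exists m => k t; rewrite /forced_rhs /lin_rhs !mulmx0 !add0r.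
Qed.

Lemma admissible_lin : admissible N a b (fun=> lin_rhs A A0).
Proof.
split=> [k u y|k t x x' y y'|]; [exact: lin_rhs_continuous|exact: lin_rhs_lipschitz|].
by exists 0 => k t; rewrite /lin_rhs !mulmx0 addr0 norm0.
Qed.

Lemma lin_solution_scale c u : lin_solution u -> lin_solution (fun t => c *: u t).
Proof.
move=> [cu du]; split=> [t|k t tk].
  by apply: cvgZr; exact: cu.
have h := du k t tk; have -> : lin_rhs A A0 t (c *: u t) (c *: u (zeta k)) =
    c *: lin_rhs A A0 t (u t) (u (zeta k)).
  by rewrite /lin_rhs -!scalemxAr scalerDr.
exact: is_deriveZ.
Qed.

Lemma lin_solution_add u1 u2 : lin_solution u1 -> lin_solution u2 ->
  lin_solution (fun t => u1 t + u2 t).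
Proof.
apply: cell_solution_add => k t.
by rewrite /lin_rhs !mulmxDr addrACA.
Qed.

Lemma lin_solution0 : lin_solution (fun=> 0).
Proof.
split=> [t|k t _]; first exact: cst_continuous.
rewrite /lin_rhs !mulmx0 addr0; exact: is_derive_cst.
Qed.

(** The columns of Z (., tau) are the solutions issued from the unit vectors; by superposition and
    uniqueness their combinations give every solution. *)
Lemma transition_exists : exists Z, is_transition t_ gamma A A0 Z.
Proof.
have ex tau xi := cell_solution_exists hN hseq a0 b0 theta0 smallness tau xi admissible_lin.
pose sol tau xi : R -> 'cV[R]_n := projT1 (cid2 (ex tau xi)).
have solP tau xi : lin_solution (sol tau xi).
  by rewrite /sol; case: cid2.
have sol_tau tau xi : sol tau xi tau = xi.
  by rewrite /sol; case: cid2.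
have uniq u1 u2 tau : lin_solution u1 -> lin_solution u2 -> u1 tau = u2 tau -> u1 = u2.
  exact: (cell_solution_uniq hN hseq a0 b0 theta0 smallness admissible_lin).
exists (fun t tau => \matrix_(i, j) sol tau (delta_mx j 0) t i 0) => tau xi.
have e t : (\matrix_(i, j) sol tau (delta_mx j 0) t i 0) *m xi = sol tau xi t.
  have -> : sol tau xi = fun t => \sum_j xi j 0 *: sol tau (delta_mx j 0) t.
    apply: (uniq _ _ tau) => //; last first.
      rewrite sol_tau [LHS]matrix_sum_delta; apply: eq_bigr => j _.
      by rewrite big_ord1 sol_tau.
    pose part (r : seq 'I_n) t := \sum_(j <- r) xi j 0 *: sol tau (delta_mx j 0) t.
    have : forall r, lin_solution (part r).
      elim=> [|j r IH].
        have -> : part [::] = (fun=> 0) by apply/funext => s; rewrite /part big_nil.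
        exact: lin_solution0.
      have -> : part (j :: r) = fun t => xi j 0 *: sol tau (delta_mx j 0) t + part r t.
        by apply/funext => s; rewrite /part big_cons.
      by apply: lin_solution_add => //; exact: lin_solution_scale.
    exact.
  apply/matrixP => i j; rewrite mxE summxE; apply: eq_bigr => k _.
  by rewrite !mxE ord1 mulrC.
have eq_fun_ : (fun t => (\matrix_(i, j) sol tau (delta_mx j 0) t i 0) *m xi) = sol tau xi.
  exact/funext.
have iff u := is_solutionP hN hseq a0 b0 theta0 smallness hgamma u admissible_lin.
split.
- by rewrite eq_fun_; apply/iff.
- by rewrite e.
- by move=> u /iff su utau t; rewrite e (uniq u (sol tau xi) tau) ?sol_tau.
Qed.

Let Z := transition t_ gamma A A0.

Let ZP : is_transition t_ gamma A A0 Z.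
Proof. by rewrite /Z /transition; apply: getPex; exact: transition_exists. Qed.

Lemma transition_solution tau (xi : 'cV[R]_n) : lin_solution (fun t => Z t tau *m xi).
Proof.
have [h _ _] := ZP tau xi.
by apply/(is_solutionP hN hseq a0 b0 theta0 smallness hgamma _ admissible_lin).
Qed.

Lemma transition_id tau (xi : 'cV[R]_n) : Z tau tau *m xi = xi.
Proof. by have [_ h _] := ZP tau xi. Qed.

Lemma transition_uniq u tau t : lin_solution u -> u t = Z t tau *m u tau.
Proof.
move=> su; have [_ _] := ZP tau (u tau); apply => //.
by apply/(is_solutionP hN hseq a0 b0 theta0 smallness hgamma _ admissible_lin).
Qed.

End linear_system.

(** The partial sums of the series over the integers pair [Posz i] with [Negz i], so the m-th one
    runs over the window -m <= r < m. *)
Lemma int_window0 (x : int) : (- 0%:Z <= x < 0%:Z) = false.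
Proof. lia. Qed.

Lemma int_window_pos (m : nat) : (- m.+1%:Z <= Posz m < m.+1%:Z) = true.
Proof. lia. Qed.

Lemma int_window_neg_out (m : nat) : (- m%:Z <= Negz m < m%:Z) = false.
Proof. lia. Qed.

Lemma int_window_neg_in (m : nat) : (- m.+1%:Z <= Negz m < m.+1%:Z) = true.
Proof. lia. Qed.

Lemma int_window_succ (m : nat) (x : int) : Posz m != x -> Negz m != x ->
  (- m.+1%:Z <= x < m.+1%:Z) = (- m%:Z <= x < m%:Z).
Proof. lia. Qed.

Lemma int_window_large (m : nat) (x : int) : (`|x| < m)%N ->
  (- m%:Z <= x < m%:Z) = true.
Proof. lia. Qed.

Lemma cvg_mulmx (R : realType) (n : nat) (Q : 'M[R]_n) (u : nat -> 'cV[R]_n) (l : 'cV[R]_n) :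
  u @ \oo --> l -> (fun m => Q *m u m) @ \oo --> Q *m l.
Proof.
have cQ : continuous (fun x : 'cV[R]_n => Q *m x).
  by apply: continuous_mulmx => x; [exact: cst_continuous|exact: cvg_id].
by move=> h; apply: (cvg_comp u (fun x : 'cV[R]_n => Q *m x) h); exact: cQ.
Qed.

(** * Bounded solutions under an exponential dichotomy *)

Section bounded_solutions.
Variables (R : realType) (n : nat) (N : 'cV[R]_n -> R).
Hypothesis hN : is_norm N.
Variables (t_ zeta : int -> R) (theta : R).
Hypothesis hseq : pca_seqs t_ zeta theta.
Variables (a b : R).
Hypotheses (a0 : 0 < a) (b0 : 0 < b) (theta0 : 0 < theta).
Hypothesis smallness : b * ((expR (a * theta) - 1) / a) < 1.
Variables (A A0 : R -> 'M[R]_n).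
Hypotheses (cA : continuous A) (cA0 : continuous A0).
Hypotheses (Aa : forall t, opnorm N (A t) <= a) (A0b : forall t, opnorm N (A0 t) <= b).

Notation lin_solution := (cell_solution t_ zeta (fun=> lin_rhs A A0)).
Notation rhoA := (rho N t_ zeta A).

(** The integrals in [rho_plus] and [rho_minus] add up to one integral over the cell, written with a
    primitive of the operator norm of [A]. The supremum is finite because this norm is at most [a]
    and cells are no longer than [theta]. *)
Lemma rho_bound : exists F : R -> R,
  (forall t, is_derive t (1 : R) F (opnorm N (A t))) /\
  forall k, expR (F (t_ (k + 1)) - F (t_ k)) <= rhoA.
Proof.
have cop : continuous (fun t => opnorm N (A t)).
  move=> t; apply: (@continuous_comp _ _ _ A (opnorm N)); first exact: cA.
  exact: opnorm_continuous.
have [F dF] := antiderivative cop; exists F; split=> // k.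
have cell_eq i : rho_plus N t_ zeta A i * rho_minus N t_ zeta A i =
    expR (F (t_ (i + 1)) - F (t_ i)).
  rewrite /rho_plus /rho_minus !(integral_of_derive _ cop dF) ?zeta_ge ?zeta_le//.
  - by rewrite -expRD; congr expR; lra.
  - exact: zeta_le hseq i.
  - exact: zeta_ge hseq i.
apply: ub_le_sup; last by exists k => //; exact: cell_eq.
exists (expR (a * theta)) => _ [i _ <-]; rewrite cell_eq ler_expR.
have dG t : is_derive t (1 : R) (fun t => a * t - F t) (a * 1 - opnorm N (A t)).
  exact: (is_derive_sub (is_derive_scale a (is_derive_id t (1 : R))) (dF t)).
have G0 t : 0 <= a * 1 - opnorm N (A t) by rewrite mulr1 subr_ge0.
have le_t : t_ i <= t_ (i + 1) by rewrite (node_le hseq)// lerDl.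
have := nondecreasing_of_derive_ge0 dG G0 le_t.
have : a * (t_ (i + 1) - t_ i) <= a * theta.
  by rewrite ler_wpM2l ?(ltW a0)// (node_step hseq).
lra.
Qed.

Lemma rho_ge1 : 1 <= rhoA.
Proof.
have [F [dF hF]] := rho_bound; apply: le_trans (hF 0); rewrite -expR0 ler_expR subr_ge0.
apply: (nondecreasing_of_derive_ge0 dF) => [t|]; first exact: opnorm_ge0.
by rewrite (node_le hseq)// lerDl.
Qed.

(** Variation of constants by comparison, in each direction from zeta_k: the majorant is W r times
    the exponential of the integral of the norm of [A], and over part of a cell that exponential is
    at most [rhoA]. *)
Lemma variation_bound (c v : R -> 'cV[R]_n) (W : R) k :
  (forall t, is_derive t (1 : R) c (A t *m c t + v t)) -> c (zeta k) = 0 ->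
  (forall s, t_ k <= s <= t_ (k + 1) -> N (v s) <= W) ->
  forall t, t_ k <= t <= t_ (k + 1) -> N (c t) <= rhoA * W * `|t - zeta k|.
Proof.
move=> dc c0 vW t ht.
have [F [dF hF]] := rho_bound.
have mF := nondecreasing_of_derive_ge0 dF (fun t => opnorm_ge0 hN (A t)).
have hz := zeta_in hseq k.
have W0 : 0 <= W by rewrite (le_trans _ (vW _ hz))// norm_ge0.
have [->|tz] := eqVneq t (zeta k); first by rewrite c0 norm0// subrr normr0 mulr0.
pose s := Num.sg (t - zeta k); pose T := `|t - zeta k|.
have s1 : `|s| = 1 by rewrite normr_sg subr_eq0 tz.
have ss : s * s = 1.
  by rewrite -expr2 -(real_normK (num_real s)) s1 expr1n.
have e : t = zeta k + s * T by rewrite /s /T -numEsg addrC subrK.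
have T0 : 0 <= T by exact: normr_ge0.
have hr r : 0 <= r <= T -> t_ k <= zeta k + s * r <= t_ (k + 1).
  move=> hr; move: e; rewrite /s; have [ts|ts|ts] := ltrgt0P (t - zeta k).
  - by rewrite gtr0_sg// mul1r; lra.
  - by rewrite ltr0_sg// mulN1r; lra.
  - by move/eqP: ts; rewrite subr_eq0 (negbTE tz).
have mono r : 0 <= r -> 0 <= s * (F (zeta k + s * r) - F (zeta k)).
  move=> r0; rewrite /s; have [ts|ts|ts] := ltrgt0P (t - zeta k).
  - by rewrite gtr0_sg// !mul1r subr_ge0 mF// lerDl.
  - by rewrite ltr0_sg// !mulN1r opprB subr_ge0 mF// gerBl.
  - by rewrite ts sgr0 mul0r.
pose psi r := expR (s * (F (zeta k + s * r) - F (zeta k))) * (W * r).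
pose psi' r := (s * (s * opnorm N (A (zeta k + s * r)) - 0) *
  expR (s * (F (zeta k + s * r) - F (zeta k)))) * (W * r) +
  expR (s * (F (zeta k + s * r) - F (zeta k))) * (W * 1).
have dpsi r : is_derive r (1 : R) psi (psi' r).
  have dFr := is_derive_sub (is_derive_reflect (dF (zeta k + s * r)))
    (is_derive_cst (F (zeta k)) r (1 : R)).
  exact: (is_derive_mul (is_derive_exp_comp (is_derive_scale s dFr))
    (is_derive_scale W (is_derive_id r (1 : R)))).
have hc : N (c t) <= psi T.
  rewrite {1}e.
  apply: (@comparison_dir _ _ _ hN c
    (fun r => A (zeta k + s * r) *m c (zeta k + s * r) + v (zeta k + s * r))
    psi psi' (fun r => opnorm N (A (zeta k + s * r))) (cst W) a (zeta k) s T) => //.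
  - by move=> x; exact: is_derive_continuous (dc x).
  - by move=> x; exact: is_derive_continuous (dpsi x).
  - move=> r /andP[r0 rT]; rewrite (le_trans (normD hN _ _))// lerD ?le_opnorm//.
    by apply: vW; apply: hr; rewrite !ltW.
  - move=> r /andP[r0 rT] /=; rewrite /psi /psi' subr0 (mulrA s s) ss mul1r mulr1.
    have : 1 <= expR (s * (F (zeta k + s * r) - F (zeta k))).
      by rewrite -expR0 ler_expR mono// ltW.
    move=> /(ler_wpM2r W0); lra.
  - by rewrite c0 norm0// /psi !mulr0.
  - by rewrite T0 lexx.
rewrite (le_trans hc)// /psi -mulrA ler_wpM2r ?mulr_ge0//.
rewrite -e (le_trans _ (hF k))// ler_expR.
have /andP[t1 t2] := ht; have /andP[z1 z2] := hz.
have f1 := mF _ _ t1; have f2 := mF _ _ t2; have f3 := mF _ _ z1; have f4 := mF _ _ z2.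
rewrite /s; have [ts|ts|ts] := ltrgt0P (t - zeta k).
- by rewrite gtr0_sg// mul1r; lra.
- by rewrite ltr0_sg// mulN1r; lra.
- by rewrite ts sgr0 mul0r; lra.
Qed.

Variables (Z : R -> R -> 'M[R]_n) (P : 'M[R]_n) (K alpha : R).
Hypothesis Z_solution : forall tau (xi : 'cV[R]_n), lin_solution (fun t => Z t tau *m xi).
Hypothesis Z_id : forall tau (xi : 'cV[R]_n), Z tau tau *m xi = xi.
Hypothesis Z_uniq : forall u tau t, lin_solution u -> u t = Z t tau *m u tau.
Hypothesis dichotomy : exp_dichotomy N Z P K alpha.

Let Z_comp t s r (xi : 'cV[R]_n) : Z t s *m (Z s r *m xi) = Z t r *m xi.
Proof. by rewrite -(Z_uniq s t (Z_solution r xi)). Qed.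

Let K1 : 1 <= K. Proof. by have [] := dichotomy. Qed.
Let K0 : 0 < K. Proof. exact: lt_le_trans ltr01 K1. Qed.
Let alpha0 : 0 < alpha. Proof. by have [] := dichotomy. Qed.

Lemma green_bound t s (x : 'cV[R]_n) :
  N (green Z P t s *m x) <= K * expR (- alpha * `|t - s|) * N x.
Proof.
have [_ _ _ h] := dichotomy.
by rewrite (le_trans (le_opnorm hN _ _))// ler_wpM2r ?norm_ge0.
Qed.

Lemma decay_le0 (x C : R) : (forall r, 0 < r -> x <= C * expR (- alpha * r)) -> x <= 0.
Proof.
move=> h; rewrite leNgt; apply/negP => x0.
(* Chosen so that x (1 + alpha r) = x + |C| + 1 > C. *)
pose r := (`|C| + 1) / (alpha * x).
have r0 : 0 < r by rewrite divr_gt0 ?mulr_gt0// ltr_wpDl.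
have := h r r0; rewrite mulNr expRN ler_pdivlMr ?expR_gt0//.
have e1 : 1 + alpha * r <= expR (alpha * r) by exact: expR_ge1Dx.
have : x * (1 + alpha * r) <= x * expR (alpha * r) by rewrite ler_wpM2l// ltW.
have -> : x * (1 + alpha * r) = x + (`|C| + 1).
  by rewrite /r; field; rewrite !lt0r_neq0.
have := ler_norm C; lra.
Qed.

(** The stable part of u t is the Green matrix applied to u (t - r), the unstable part minus the one
    applied to u (t + r). Boundedness and decay as r grows make both vanish. *)
Lemma bounded_lin_solution_eq0 u C : lin_solution u -> (forall t, N (u t) <= C) ->
  forall t, u t = 0.
Proof.
move=> su uC t.
have Zu s : Z 0 s *m u s = u 0 by rewrite -(Z_uniq s 0 su).
have stable : N (Z t 0 *m (P *m u 0)) <= 0.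
  apply: (@decay_le0 _ (K * C)) => r r0.
  have := green_bound t (t - r) (u (t - r)).
  rewrite /green gerBl (ltW r0) -mulmxA Zu -mulmxA => /le_trans; apply.
  have -> : t - (t - r) = r by lra.
  by rewrite gtr0_norm// mulrAC ler_wpM2r ?expR_ge0// ler_wpM2l ?uC// ltW.
have unstable : N (Z t 0 *m ((1%:M - P) *m u 0)) <= 0.
  apply: (@decay_le0 _ (K * C)) => r r0.
  have := green_bound t (t + r) (u (t + r)).
  rewrite /green; have -> : (t + r <= t) = false by rewrite gerDl leNgt r0.
  rewrite mulNmx normN// -(mulmxA _ (Z 0 (t + r))) Zu -mulmxA => /le_trans; apply.
  have -> : t - (t + r) = - r by lra.
  by rewrite normrN gtr0_norm// mulrAC ler_wpM2r ?expR_ge0// ler_wpM2l ?uC// ltW.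
have zero x : N x <= 0 -> x = 0.
  by move=> x0; apply: (norm_eq0 hN); apply/eqP; rewrite eq_le x0 norm_ge0.
rewrite (Z_uniq 0 t su).
have -> : u 0 = P *m u 0 + (1%:M - P) *m u 0 by rewrite -mulmxDl addrC subrK mul1mx.
by rewrite mulmxDr (zero _ stable) (zero _ unstable) addr0.
Qed.

(** A weight growing at rate at most [beta] < [alpha] costs the Green kernel only the change of its
    rate to alpha - beta. *)
Definition is_weight (beta : R) (p : R -> R) : Prop :=
  [/\ 0 <= beta < alpha, forall s, 0 <= p s
    & forall s t, p s <= expR (beta * `|s - t|) * p t].

Section construction.
Variables (v : int -> R -> 'cV[R]_n) (c : int -> R -> 'cV[R]_n).
Hypothesis dc : forall k t, is_derive t (1 : R) (c k) (A t *m c k t + v k t).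
Hypothesis c_zeta : forall k, c k (zeta k) = 0.

Let j r := c (r - 1) (t_ r) - c r (t_ r).

(** Green terms pulled back to time 0. On cell [k] the choice between P and I - P depends on [k]
    alone, so the series is Z (t, 0) applied to one vector per cell. *)
Let C k r := if r <= k then P *m (Z 0 (t_ r) *m j r)
  else - ((1%:M - P) *m (Z 0 (t_ r) *m j r)).

Let S k := series (fun m => C k (Posz m) + C k (Negz m)).

Let green_term k t r : t_ k <= t < t_ (k + 1) ->
  Z t 0 *m C k r = green Z P t (t_ r) *m j r.
Proof.
move=> /andP[kt tk]; rewrite /C /green; have [rk|kr] := leP r k.
  by rewrite (le_trans (node_le hseq rk) kt) !mulmxA.
have tr : t < t_ r by rewrite (lt_le_trans tk)// (node_le hseq)// lezD1.
by rewrite leNgt tr/= mulmxN mulNmx !mulmxA.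
Qed.

Section estimate.
Variables (beta : R) (p : R -> R) (W : R).
Hypotheses (hp : is_weight beta p) (W0 : 0 <= W).
Hypothesis vW : forall k s, t_ k <= s <= t_ (k + 1) -> N (v k s) <= W * p s.

Let beta0 : 0 <= beta. Proof. by have [/andP[]] := hp. Qed.
Let p0 s : 0 <= p s. Proof. by have [_ h _] := hp. Qed.
(** The factor exp(beta theta) covers the variation of [p] within a cell. *)
Let hW s := W * (expR (beta * theta) * p s).
Let hW0 s : 0 <= hW s.
Proof. by rewrite !mulr_ge0 ?expR_ge0. Qed.
Let rho0 : 0 <= rhoA. Proof. exact: le_trans ler01 rho_ge1. Qed.

Let c_bound k t : t_ k <= t <= t_ (k + 1) -> N (c k t) <= rhoA * hW t * `|t - zeta k|.
Proof.
move=> ht; apply: (variation_bound (dc k) (c_zeta k) _ ht) => s hs.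
rewrite (le_trans (vW hs))// ler_wpM2l//; have [_ _ h] := hp.
rewrite (le_trans (h s t))// ler_wpM2r// ler_expR ler_wpM2l//.
have := node_step hseq k; rewrite ler_norml; lra.
Qed.

Let jump_bound r : N (j r) <= rhoA * hW (t_ r) * (zeta r - zeta (r - 1)).
Proof.
have lt1 : t_ (r - 1) <= t_ r by rewrite (node_le hseq)// gerBl.
have lt2 : t_ r <= t_ (r + 1) by rewrite (node_le hseq)// lerDl.
rewrite /j (le_trans (normB hN _ _))//.
have h1 : N (c (r - 1) (t_ r)) <= rhoA * hW (t_ r) * `|t_ r - zeta (r - 1)|.
  by apply: c_bound; rewrite subrK lexx lt1.
have h2 : N (c r (t_ r)) <= rhoA * hW (t_ r) * `|t_ r - zeta r|.
  by apply: c_bound; rewrite lexx lt2.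
rewrite ger0_norm ?subr_ge0 ?(zeta_pred_le hseq)// in h1.
rewrite distrC ger0_norm ?subr_ge0 ?(zeta_ge hseq)// in h2.
lra.
Qed.

Let alpha' := alpha - beta.
Let alpha'0 : 0 < alpha'. Proof. by have [/andP[_ h]] := hp; rewrite subr_gt0. Qed.

Let term_bound t r : N (green Z P t (t_ r) *m j r) <=
  K * (rhoA * hW t) * kernel_weight t_ zeta alpha' t r.
Proof.
rewrite (le_trans (green_bound _ _ _))//.
have h1 := jump_bound r.
have z0 : 0 <= zeta r - zeta (r - 1).
  by rewrite subr_ge0 (le_trans (zeta_pred_le hseq r))// (zeta_ge hseq).
have h2 : hW (t_ r) <= expR (beta * `|t - t_ r|) * hW t.
  have [_ _ h] := hp; rewrite /hW.
  have -> : expR (beta * `|t - t_ r|) * (W * (expR (beta * theta) * p t)) =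
      W * (expR (beta * theta) * (expR (beta * `|t - t_ r|) * p t)) by ring.
  by rewrite ler_wpM2l// ler_wpM2l ?expR_ge0// distrC.
apply: (@le_trans _ _ (K * expR (- alpha * `|t - t_ r|) *
    (rhoA * (expR (beta * `|t - t_ r|) * hW t) * (zeta r - zeta (r - 1))))).
  rewrite ler_wpM2l ?mulr_ge0 ?expR_ge0 ?(ltW K0)// (le_trans h1)//.
  by rewrite ler_wpM2r// ler_wpM2l.
rewrite /kernel_weight.
have -> : expR (- alpha' * `|t - t_ r|) =
    expR (- alpha * `|t - t_ r|) * expR (beta * `|t - t_ r|).
  by rewrite -expRD /alpha'; congr expR; ring.
by rewrite le_eqVlt; apply/orP; left; apply/eqP; ring.
Qed.

Let total_bound k t m : t_ k <= t < t_ (k + 1) ->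
  N (c k t + Z t 0 *m S k m) <= 2 * K * (rhoA * expR (alpha * theta)) / alpha' * W * p t.
Proof.
move=> ht; have ht' : t_ k <= t <= t_ (k + 1) by case/andP: ht => -> /ltW ->.
rewrite (le_trans (normD hN _ _))//.
have s_bound : N (Z t 0 *m S k m) <= K * (rhoA * hW t) * \sum_(0 <= i < m)
    (kernel_weight t_ zeta alpha' t (Posz i) + kernel_weight t_ zeta alpha' t (Negz i)).
  rewrite /S /series/= mulmx_sumr mulr_sumr (le_trans (norm_sum hN _ _))//.
  apply: ler_sum => i _; rewrite mulmxDr (le_trans (normD hN _ _))// mulrDr.
  by rewrite !(green_term _ ht) lerD.
(* K >= 1 lets the local term share the constant of the series. *)
have c_b : N (c k t) <= K * (rhoA * hW t) * `|t - zeta k|.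
  rewrite (le_trans (c_bound ht'))// ler_wpM2r// ler_peMl// mulr_ge0//.
rewrite (le_trans (lerD c_b s_bound))// -mulrDr.
rewrite (le_trans (ler_wpM2l _ (kernel_sum_le hseq alpha'0 ht' m)))//.
  by rewrite mulr_ge0 ?mulr_ge0// ltW.
rewrite le_eqVlt; apply/orP; left; apply/eqP; rewrite /hW.
(* The variation of the weight within a cell and the kernel sum at rate alpha - beta recombine to
   exp(alpha theta), whatever [beta] is. *)
have -> : expR (alpha * theta) = expR (beta * theta) * expR (alpha' * theta).
  by rewrite -expRD /alpha'; congr expR; ring.
by field; exact: lt0r_neq0.
Qed.

(** Convergence is tested at t_k, where the Green bound applies, and pulled back to time 0 by the
    fixed matrix Z (0, t_k). *)
Lemma partial_sums_cvg k : cvgn (S k).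
Proof.
pose D := opnorm N (Z 0 (t_ k)) * (K * (rhoA * hW (t_ k))).
pose w m := kernel_weight t_ zeta alpha' (t_ k) (Posz m) +
  kernel_weight t_ zeta alpha' (t_ k) (Negz m).
have kk : t_ k <= t_ k < t_ (k + 1) by rewrite lexx (node_lt hseq)// ltzD1.
have kk' : t_ k <= t_ k <= t_ (k + 1) by case/andP: kk => -> /ltW ->.
have w0 m : 0 <= w m by rewrite addr_ge0// (kernel_weight_ge0 hseq).
have termk r : N (C k r) <= D * kernel_weight t_ zeta alpha' (t_ k) r.
  have -> : C k r = Z 0 (t_ k) *m (Z (t_ k) 0 *m C k r) by rewrite Z_comp Z_id.
  rewrite (green_term _ kk) (le_trans (le_opnorm hN _ _))// /D -mulrA.
  by rewrite ler_wpM2l ?opnorm_ge0// term_bound.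
apply: (@norm_series_cvg _ _ _ hN _ (fun m => D * w m)) => [m|].
  by rewrite (le_trans (normD hN _ _))// /w mulrDr lerD// termk.
apply: (@is_cvg_seriesZ R w D).
apply: nondecreasing_is_cvgn; first exact: nondecreasing_series.
exists (2 * expR (alpha' * theta) / alpha') => _ [m _ <-].
apply: le_trans (kernel_sum_le hseq alpha'0 kk' m).
by rewrite /series/= lerDr.
Qed.

Lemma limit_bound k t : t_ k <= t < t_ (k + 1) ->
  N (c k t + Z t 0 *m limn (S k)) <=
  2 * K * (rhoA * expR (alpha * theta)) / alpha' * W * p t.
Proof.
move=> ht.
have cv : (fun m => N (c k t + Z t 0 *m S k m)) @ \oo -->
    N (c k t + Z t 0 *m limn (S k)).
  apply: continuous_cvg; first exact: (is_norm_continuous hN).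
  apply: cvgD; first exact: cvg_cst.
  exact: cvg_mulmx (@partial_sums_cvg k).
rewrite -(cvg_lim _ cv)//; apply: limr_le; first by apply/cvg_ex; eexists; exact: cv.
by apply: nearW => m; exact: total_bound.
Qed.

End estimate.

(** From cell [k] to the next, only the term r = k + 1 changes, from the I - P branch to the P
    branch; the two differ by the full vector Z (0, t_(k+1)) j_(k+1), seen once the window contains
    k + 1. *)
Let S_succ k m : S (k + 1) m = S k m +
  (if (- m%:Z <= k + 1 < m%:Z) then Z 0 (t_ (k + 1)) *m j (k + 1) else 0).
Proof.
have C_ne r : r != k + 1 -> C (k + 1) r = C k r.
  move=> rk; rewrite /C; have [h|h] := leP r k.
    by rewrite (le_trans h)// lerDl.
  by rewrite leNgt lt_neqAle eq_sym rk/= lezD1 h.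
have C_eq : C (k + 1) (k + 1) = C k (k + 1) + Z 0 (t_ (k + 1)) *m j (k + 1).
  rewrite /C lexx leNgt ltzD1 lexx/= mulmxBl mul1mx.
  by rewrite opprB subrK.
elim: m => [|m IH]; first by rewrite /S /series/= !big_geq// int_window0 addr0.
have Sr i : S i m.+1 = S i m + (C i (Posz m) + C i (Negz m)) by rewrite /S seriesSr.
rewrite !Sr IH.
have [e|e] := eqVneq (Posz m) (k + 1).
  rewrite -e in C_ne C_eq *; rewrite ltxx andbF int_window_pos (C_ne (Negz m))//.
  by rewrite C_eq addr0 (addrAC (C k (Posz m))) !addrA.
have [e'|e'] := eqVneq (Negz m) (k + 1).
  rewrite -e' in C_ne C_eq *; rewrite int_window_neg_out int_window_neg_in (C_ne (Posz m))//.
  by rewrite C_eq addr0 !addrA.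
by rewrite !C_ne// int_window_succ// addrAC.
Qed.

Lemma limit_succ (k : int) : cvgn (S k) ->
  limn (S (k + 1)) = limn (S k) + Z 0 (t_ (k + 1)) *m j (k + 1).
Proof.
move=> cv; apply: cvg_lim => //.
have h : S k m + Z 0 (t_ (k + 1)) *m j (k + 1) @[m --> \oo] -->
    limn (S k) + Z 0 (t_ (k + 1)) *m j (k + 1).
  by apply: cvgD => //; exact: cvg_cst.
apply: cvg_trans h; apply: near_eq_cvg; exists (`|(k + 1)%R|.+1)%N => // m /= hm.
by rewrite S_succ int_window_large.
Qed.

(** The jump of the series at t_(k+1) is j_(k+1), exactly what compensates the passage from c_k to
    c_(k+1). *)
Lemma limit_match (k : int) : cvgn (S k) ->
  c k (t_ (k + 1)) + Z (t_ (k + 1)) 0 *m limn (S k) =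
  c (k + 1) (t_ (k + 1)) + Z (t_ (k + 1)) 0 *m limn (S (k + 1)).
Proof.
move=> cv; rewrite limit_succ// mulmxDr Z_comp Z_id /j addrK.
by rewrite [RHS]addrCA (addrC (c (k + 1) _)) subrK addrC.
Qed.

(** The vectors [xi] are obtained once, with the constant weight, and the same vectors then satisfy
    the estimate for every weight. *)
Lemma matching_data_exist m : (forall k t, N (v k t) <= m) ->
  exists xi : int -> 'cV[R]_n,
    (forall k, c k (t_ (k + 1)) + Z (t_ (k + 1)) 0 *m xi k =
       c (k + 1) (t_ (k + 1)) + Z (t_ (k + 1)) 0 *m xi (k + 1)) /\
    forall beta p W, is_weight beta p -> 0 <= W ->
    (forall k s, t_ k <= s <= t_ (k + 1) -> N (v k s) <= W * p s) ->
    forall k t, t_ k <= t < t_ (k + 1) -> N (c k t + Z t 0 *m xi k) <=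
      2 * K * (rhoA * expR (alpha * theta)) / (alpha - beta) * W * p t.
Proof.
move=> vm.
have w1 : is_weight 0 (fun=> 1).
  by split=> [|s|s t]; rewrite ?lexx ?alpha0// mul0r expR0 mulr1.
have m0 : 0 <= m by rewrite (le_trans _ (vm 0 0))// norm_ge0.
have v1 k s : t_ k <= s <= t_ (k + 1) -> N (v k s) <= m * (fun=> 1) s.
  by move=> _; rewrite mulr1.
exists (fun k => limn (S k)); split=> [k|beta p W hp W0 vW k t].
  apply: limit_match; exact: (partial_sums_cvg w1 m0 v1).
exact: limit_bound hp W0 vW k t.
Qed.

End construction.

Lemma bounded_solution_exists (v : int -> R -> 'cV[R]_n) m :
  (forall k, continuous (v k)) -> (forall k t, N (v k t) <= m) ->
  exists z, cell_solution t_ zeta (forced_rhs A A0 v) z /\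
    forall beta p W, is_weight beta p -> 0 <= W ->
    (forall k s, t_ k <= s <= t_ (k + 1) -> N (v k s) <= W * p s) ->
    forall t, N (z t) <=
      2 * K * (rhoA * expR (alpha * theta)) / (alpha - beta) * W * p t.
Proof.
move=> cv vm.
have aG := admissible_forced hN cA cA0 Aa A0b cv vm.
have ex k : exists2 c : R -> 'cV[R]_n,
    forall t, is_derive t (1 : R) c (forced_rhs A A0 v k t (c t) (c (zeta k))) &
    c (zeta k) = 0.
  exact: (cell_ivp hN hseq a0 b0 theta0 smallness 0 aG (zeta_in hseq k)).
pose c k := projT1 (cid2 (ex k)).
have c_zeta k : c k (zeta k) = 0 by rewrite /c; case: cid2.
have dc k t : is_derive t (1 : R) (c k) (A t *m c k t + v k t).
  have : is_derive t (1 : R) (c k) (forced_rhs A A0 v k t (c k t) (c k (zeta k))).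
    by rewrite /c; case: cid2.
  by rewrite c_zeta /forced_rhs /lin_rhs mulmx0 addr0.
have [xi [xi_match xi_bound]] := matching_data_exist dc c_zeta vm.
pose U k t := c k t + Z t 0 *m xi k.
have cc k : continuous (c k) by move=> x; exact: is_derive_continuous (dc k x).
have cU k : continuous (U k).
  by apply: continuous_add => //; have [] := Z_solution 0 (xi k).
have dU k t : t_ k < t < t_ (k + 1) ->
    is_derive t (1 : R) (U k) (forced_rhs A A0 v k t (U k t) (U k (zeta k))).
  move=> tk; have [_ dZ] := Z_solution 0 (xi k).
  have -> : forced_rhs A A0 v k t (U k t) (U k (zeta k)) = A t *m c k t + v k t +
      lin_rhs A A0 t (Z t 0 *m xi k) (Z (zeta k) 0 *m xi k).
    by rewrite /forced_rhs /lin_rhs /U c_zeta add0r mulmxDr [RHS]addrACA -[LHS]addrA;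
      congr (_ + _); exact: addrC.
  exact: is_derive_add (dc k t) (dZ k t tk).
have [z [sz zE]] := glue_cells hseq cU dU xi_match.
exists z; split=> // beta p W hp W0 vW t.
have tk := cellP hseq t; have /andP[t1 t2] := tk.
rewrite (zE (cell hseq t)); last by rewrite t1 ltW.
exact: xi_bound hp W0 vW _ _ tk.
Qed.

End bounded_solutions.

(** * Conjugacy *)

Section conjugacy.
Variables (R : realType) (n : nat) (N : 'cV[R]_n -> R).
Hypothesis hN : is_norm N.
Variables (t_ zeta : int -> R) (theta : R).
Hypothesis hseq : pca_seqs t_ zeta theta.
Variables (a b : R).
Hypotheses (a0 : 0 < a) (b0 : 0 < b) (theta0 : 0 < theta).
Hypothesis smallness : b * ((expR (a * theta) - 1) / a) < 1.
Variables (A A0 : R -> 'M[R]_n).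
Hypotheses (cA : continuous A) (cA0 : continuous A0).
Hypotheses (Aa : forall t, opnorm N (A t) <= a) (A0b : forall t, opnorm N (A0 t) <= b).
Variables (Z : R -> R -> 'M[R]_n) (P : 'M[R]_n) (K alpha : R).
Notation lin_solution := (cell_solution t_ zeta (fun=> lin_rhs A A0)).
Notation rhoA := (rho N t_ zeta A).
Hypothesis Z_solution : forall tau (xi : 'cV[R]_n), lin_solution (fun t => Z t tau *m xi).
Hypothesis Z_id : forall tau (xi : 'cV[R]_n), Z tau tau *m xi = xi.
Hypothesis Z_uniq : forall u tau t, lin_solution u -> u t = Z t tau *m u tau.
Hypothesis dichotomy : exp_dichotomy N Z P K alpha.
Variables (f : R -> 'cV[R]_n -> 'cV[R]_n -> 'cV[R]_n) (mu l1 l2 : R).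
Hypothesis cf : continuous (fun p : R * 'cV[R]_n * 'cV[R]_n => f p.1.1 p.1.2 p.2).
Hypotheses (mu0 : 0 < mu) (l10 : 0 < l1) (l20 : 0 < l2).
Hypothesis f_mu : forall t x y, N (f t x y) <= mu.
Hypothesis f_lip : forall t x x' y y',
  N (f t x y - f t x' y') <= l1 * N (x - x') + l2 * N (y - y').
Hypothesis admissible_nonlin : admissible N a b (fun=> nonlin_rhs A A0 f).
Hypothesis small_gain : 2 * (l1 + l2) * K * (rhoA * expR (alpha * theta)) < alpha.

Notation nonlin_solution := (cell_solution t_ zeta (fun=> nonlin_rhs A A0 f)).

(** The norm of the solution operator for forcings dominated by a weight of rate [beta]; small_gain
    says gain 0 (l1 + l2) < 1. *)
Let gain beta := 2 * K * (rhoA * expR (alpha * theta)) / (alpha - beta).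

Let alpha0 : 0 < alpha. Proof. by have [] := dichotomy. Qed.
Let K0 : 0 < K. Proof. by have [_ h _ _] := dichotomy; exact: lt_le_trans ltr01 h. Qed.
Let rho0 : 0 < rhoA.
Proof. exact: lt_le_trans ltr01 (rho_ge1 hN hseq a0 cA Aa). Qed.

Let gain_gt0 beta : beta < alpha -> 0 < gain beta.
Proof. by move=> h; rewrite divr_gt0 ?subr_gt0// !mulr_gt0// expR_gt0. Qed.

Lemma f_comp_continuous u y : continuous u -> continuous (fun t => f t (u t) y).
Proof.
move=> cu t; apply: (@continuous_comp _ _ _ (fun t => (t, u t, y))
  (fun p : R * 'cV[R]_n * 'cV[R]_n => f p.1.1 p.1.2 p.2)); last exact: cf.
exact: (cvg_pair (cvg_pair (@cvg_id _ (nbhs t)) (cu t)) (cvg_cst y)).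
Qed.

Lemma weight_const : is_weight alpha 0 (fun=> 1).
Proof. by split=> [|s|s t]; rewrite ?lexx ?alpha0// mul0r expR0 mulr1. Qed.

Lemma weight_exp beta tau : 0 <= beta < alpha ->
  is_weight alpha beta (fun t => expR (beta * `|t - tau|)).
Proof.
move=> hb; split=> [//|s|s t]; first exact: expR_ge0.
have /andP[hb0 _] := hb.
rewrite -expRD ler_expR -mulrDr ler_wpM2l//.
by rewrite (le_trans _ (ler_normD _ _))// addrA subrK.
Qed.

(** The estimates hold for any bounded solution, not only the constructed one: the two differ by a
    bounded linear solution, which is zero. *)
Lemma forced_bounded_estimate v z m C : (forall k, continuous (v k)) ->
  (forall k t, N (v k t) <= m) ->
  cell_solution t_ zeta (forced_rhs A A0 v) z -> (forall t, N (z t) <= C) ->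
  forall beta p W, is_weight alpha beta p -> 0 <= W ->
    (forall k s, t_ k <= s <= t_ (k + 1) -> N (v k s) <= W * p s) ->
    forall t, N (z t) <= gain beta * W * p t.
Proof.
move=> cv vm sz zC beta p W hp W0 vW t.
have [z' [sz' est]] := bounded_solution_exists hN hseq a0 b0 theta0 smallness cA cA0
  Aa A0b Z_solution Z_id Z_uniq dichotomy cv vm.
have m0 : 0 <= m by rewrite (le_trans _ (vm 0 0))// norm_ge0.
have vm' k s : t_ k <= s <= t_ (k + 1) -> N (v k s) <= m * 1 by rewrite mulr1.
have est0 := est _ _ _ weight_const m0 vm'.
have sd : lin_solution (fun t => z t - z' t).
  apply: cell_solution_sub sz sz' => k s.
  rewrite /forced_rhs /lin_rhs !mulmxBr opprD (addrACA _ (v k s)) subrr addr0.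
  by rewrite opprD addrACA.
have := bounded_lin_solution_eq0 hN Z_uniq dichotomy sd (C := C + gain 0 * m * 1) _ t.
move=> /(_ _)/eqP; rewrite subr_eq0 => h; rewrite (eqP (h _)); first exact: (est _ _ _ hp W0 vW t).
by move=> s; rewrite (le_trans (normB hN _ _))// lerD.
Qed.

(* The exponential weight with small [beta] keeps the gain below 1 while
   dominating the bounded forcing outside a compact window around [tau]. *)
Lemma small_bounded_solution tau e C m : 0 < e -> 0 <= m -> exists2 d, 0 < d &
  forall v z g, (forall k, continuous (v k)) -> (forall k t, N (v k t) <= m) ->
    cell_solution t_ zeta (forced_rhs A A0 v) z -> (forall t, N (z t) <= C) ->
    difference_inequality N t_ zeta a b g ->
    (forall k s, t_ k <= s <= t_ (k + 1) -> N (v k s) <=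
      l1 * N (z s) + l2 * N (z (zeta k)) + (l1 * N (g s) + l2 * N (g (zeta k)))) ->
    N (g tau) < d -> N (z tau) <= e.
Proof.
move=> e0 m0.
have [beta [bpos blt bgain]] : exists beta, [/\ 0 < beta, beta < alpha &
    gain beta * (l1 + l2 * expR (beta * theta)) < 1].
  pose c := 2 * K * (rhoA * expR (alpha * theta)).
  (* The condition on [beta] reads h beta < alpha; it holds at 0 by small_gain, hence nearby by
     continuity. *)
  pose h x := c * (l1 + l2 * expR (theta * (x - 0))) + x.
  have dh x := is_derive_add (is_derive_scale c (is_derive_add (is_derive_cst l1 x (1 : R))
    (is_derive_scale l2 (is_derive_exp_scale theta 0 x)))) (is_derive_id x (1 : R)).
  have ch : h x @[x --> (0 : R)] --> h 0 by exact: is_derive_continuous (dh 0).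
  have h0 : h 0 < alpha.
    by rewrite /h subrr mulr0 expR0 mulr1 addr0 /c; move: small_gain; lra.
  have /nbhs_ballP[r /= r0 hr] : \forall x \near (0 : R), h x < alpha.
    exact: (cvgr_lt _ ch).
  exists (Num.min (r / 2) (alpha / 2)).
  set beta := Num.min _ _.
  have b1 : beta <= r / 2 by rewrite ge_min lexx.
  have b2 : beta <= alpha / 2 by rewrite ge_min lexx orbT.
  have b3 : 0 < beta by rewrite lt_min !divr_gt0.
  have ba : beta < alpha by lra.
  split=> //.
  have : h beta < alpha.
    by apply: hr; rewrite -ball_normE/= sub0r normrN gtr0_norm//; lra.
  rewrite /gain mulrAC ltr_pdivrMr ?subr_gt0// mul1r -/c /h subr0 (mulrC theta).
  by rewrite ltrBrDr.
pose q := gain beta * (l1 + l2 * expR (beta * theta)).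
have q1 : 0 < 1 - q by rewrite subr_gt0.
have G0 : 0 < gain beta by exact: gain_gt0.
(* The forcing level for which the final inequality becomes S <= q S + e (1 - q), that is S <= e. *)
pose W0 := e * (1 - q) / gain beta.
have W00 : 0 < W0 by rewrite divr_gt0// mulr_gt0.
(* Beyond distance [T] from [tau] the weighted level W0 p already exceeds the uniform bound [m]. *)
pose T := m / W0 / beta.
have T0 : 0 <= T by rewrite divr_ge0 ?(ltW bpos)// divr_ge0// ltW.
have [D D0 hD] := window_growth hN hseq a0 b0 theta0 smallness tau (T + theta).
have l0 : 0 < l1 + l2 by rewrite addr_gt0.
(* [D] controls [g] on the window enlarged by theta, which also contains zeta k, so the terms in [g]
   stay below [W0] there. *)
exists (W0 / ((l1 + l2) * D)) => [|v z g cv vm sz zC hg vb gd].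
  by rewrite divr_gt0// mulr_gt0.
pose p t := expR (beta * `|t - tau|).
have hb : 0 <= beta < alpha by rewrite ltW.
have hp : is_weight alpha beta p by exact: weight_exp.
have p1 t : 1 <= p t by rewrite -expR0 ler_expR mulr_ge0// ltW.
have p0 t : 0 < p t by exact: expR_gt0.
(* Finite because [z] is bounded and p >= 1; this makes it legitimate to absorb q S. *)
pose S := sup (range (fun t => N (z t) / p t)).
have hub : has_ubound (range (fun t => N (z t) / p t)).
  exists C => _ [t _ <-]; rewrite ler_pdivrMr//.
  have C0 : 0 <= C by rewrite (le_trans _ (zC t))// norm_ge0.
  by rewrite (le_trans (zC t))// ler_peMr.
have zS t : N (z t) <= S * p t.
  by rewrite -ler_pdivrMr//; apply: ub_le_sup => //; exists t.
have S0 : 0 <= S.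
  by rewrite -(pmulr_lge0 _ (p0 0)) (le_trans _ (zS 0))// norm_ge0.
have vW k s : t_ k <= s <= t_ (k + 1) ->
    N (v k s) <= ((l1 + l2 * expR (beta * theta)) * S + W0) * p s.
  move=> hs; have hz := zeta_in hseq k; have hst := node_step hseq k.
  have zs : `|zeta k - s| <= theta by rewrite ler_norml; lra.
  have Sp : 0 <= (l1 + l2 * expR (beta * theta)) * S * p s.
    by rewrite !mulr_ge0 ?(ltW (p0 s))// addr_ge0 ?mulr_ge0 ?expR_ge0// ltW.
  rewrite mulrDl.
  have [Ts|sT] := leP T `|s - tau|.
    rewrite (le_trans (vm k s))// ler_wpDl//.
    have h1 : 1 + beta * `|s - tau| <= p s by exact: expR_ge1Dx.
    have h2 : m / W0 <= beta * `|s - tau|.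
      by rewrite (mulrC beta) -ler_pdivrMr.
    rewrite mulrC -ler_pdivrMr//; lra.
  have gw x : `|x - tau| <= T + theta -> N (g x) <= W0 / (l1 + l2).
    move=> hx; rewrite (le_trans (hD g hg x hx))// mulrC -ler_pdivlMr//.
    by rewrite (le_trans (ltW gd))// invfM mulrA.
  have g1 : N (g s) <= W0 / (l1 + l2) by apply: gw; move: sT theta0; lra.
  have g2 : N (g (zeta k)) <= W0 / (l1 + l2).
    apply: gw; have := ler_normD (zeta k - s) (s - tau); rewrite addrA subrK; lra.
  have z2 : N (z (zeta k)) <= S * (expR (beta * theta) * p s).
    rewrite (le_trans (zS _))// ler_wpM2l//; have [_ _ h] := hp.
    rewrite (le_trans (h _ s))// ler_wpM2r ?(ltW (p0 s))// ler_expR ler_wpM2l ?(ltW bpos)//.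
  rewrite (le_trans (vb k s hs))// lerD//.
    have := ler_wpM2l (ltW l10) (zS s); have := ler_wpM2l (ltW l20) z2; lra.
  apply: (@le_trans _ _ W0); last by rewrite ler_peMr// ltW.
  have := ler_wpM2l (ltW l10) g1; have := ler_wpM2l (ltW l20) g2.
  have : l1 * (W0 / (l1 + l2)) + l2 * (W0 / (l1 + l2)) = W0.
    by field; exact: lt0r_neq0.
  lra.
have Wge0 : 0 <= (l1 + l2 * expR (beta * theta)) * S + W0.
  by rewrite addr_ge0 ?(ltW W00)// mulr_ge0// addr_ge0 ?mulr_ge0 ?expR_ge0// ltW.
have est := forced_bounded_estimate cv vm sz zC hp Wge0 vW.
have Sle : S <= gain beta * ((l1 + l2 * expR (beta * theta)) * S + W0).
  apply: ge_sup; first by exists (N (z 0) / p 0), 0.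
  by move=> _ [t _ <-]; rewrite ler_pdivrMr.
have e1 : gain beta * ((l1 + l2 * expR (beta * theta)) * S + W0) = q * S + e * (1 - q).
  by rewrite /W0 /q; field; exact: lt0r_neq0.
have Se : S <= e.
  by rewrite -(ler_pM2r q1); move: Sle; rewrite e1; lra.
by rewrite (le_trans (zS tau))// /p subrr normr0 mulr0 expR0 mulr1.
Qed.

(** The bound is explicit, and common to all pairs, so that the d of the closeness estimate does not
    depend on the pair; it is also the bound on H (t, u) - u. *)
Definition conjugate (x y : R -> 'cV[R]_n) : Prop :=
  [/\ nonlin_solution x, lin_solution y &
      forall t, N (x t - y t) <= 2 * K * (rhoA * expR (alpha * theta)) / alpha * mu].

Lemma lin_partner_exists x : nonlin_solution x ->
  exists y, conjugate x y.
Proof.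
move=> sx; have cx : continuous x by have [] := sx.
pose v (k : int) t := - f t (x t) (x (zeta k)).
have cv k : continuous (v k).
  by move=> t; apply: cvgN; exact: f_comp_continuous.
have vm k t : N (v k t) <= mu by rewrite /v normN.
have [z [sz est]] := bounded_solution_exists hN hseq a0 b0 theta0 smallness cA cA0
  Aa A0b Z_solution Z_id Z_uniq dichotomy cv vm.
exists (fun t => x t + z t); split=> // [|t].
  apply: cell_solution_add sx sz => k t.
  rewrite /nonlin_rhs /forced_rhs /lin_rhs !mulmxDr /v.
  by rewrite [RHS]addrACA subrr addr0 addrACA.
rewrite opprD addrA subrr add0r normN// -[leRHS]mulr1 -[X in _ / X]subr0.
by apply: (est _ _ _ weight_const (ltW mu0)) => k s _; rewrite mulr1.
Qed.

Lemma nonlin_partner_exists y : lin_solution y ->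
  exists x, conjugate x y.
Proof.
move=> sy; have cy : continuous y by have [] := sy.
pose v (z : R -> 'cV[R]_n) (k : int) t := f t (y t + z t) (y (zeta k) + z (zeta k)).
have cv z : continuous z -> forall k, continuous (v z k).
  by move=> cz k; apply: f_comp_continuous; exact: continuous_add.
have vm z k t : N (v z k t) <= mu by exact: f_mu.
(* For discontinuous [z] the value is arbitrary, so that T is a total function; the contraction is
   used on continuous functions only. *)
have ex z : exists z', continuous z -> cell_solution t_ zeta (forced_rhs A A0 (v z)) z' /\
    forall t, N (z' t) <= gain 0 * mu.
  have [cz|ncz] := pselect (continuous z); last by exists 0 => /ncz.
  have [z' [sz' est]] := bounded_solution_exists hN hseq a0 b0 theta0 smallness cA cA0
    Aa A0b Z_solution Z_id Z_uniq dichotomy (cv z cz) (vm z).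
  exists z' => _; split=> // t; rewrite -[leRHS]mulr1.
  by apply: (est _ _ _ weight_const (ltW mu0)) => k s _; rewrite mulr1.
pose T z := projT1 (cid (ex z)).
have TP z (cz : continuous z) : cell_solution t_ zeta (forced_rhs A A0 (v z)) (T z) /\
    forall t, N (T z t) <= gain 0 * mu.
  exact: (projT2 (cid (ex z))).
have g0 : 0 < gain 0 by exact: gain_gt0.
pose q := gain 0 * (l1 + l2).
have q1 : 0 <= q < 1.
  rewrite mulr_ge0 ?(ltW g0) ?addr_ge0 ?(ltW l10) ?(ltW l20)//=.
  rewrite /q /gain subr0 mulrAC ltr_pdivrMr// mul1r; move: small_gain; lra.
have [|||||||z cz Tz] := @weighted_fixpoint _ _ _ hN (cst 1) T q (gain 0 * mu) (cst 0) q1.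
- exact: cst_continuous.
- by [].
- by move=> u cu; have [[]] := TP u cu.
- move=> u1 u2 c c1 c2 c0 hu t.
  have [s1 b1] := TP u1 c1; have [s2 b2] := TP u2 c2.
  rewrite /cst mulr1 /q -mulrA -[leRHS]mulr1.
  pose dv (k : int) t := v u1 k t - v u2 k t.
  have cdv k : continuous (dv k) by apply: continuous_sub; exact: cv.
  have dvm k s : N (dv k s) <= mu + mu by rewrite (le_trans (normB hN _ _))// lerD.
  have sd : cell_solution t_ zeta (forced_rhs A A0 dv) (fun t => T u1 t - T u2 t).
    apply: cell_solution_sub s1 s2 => k s.
    rewrite /forced_rhs /lin_rhs !mulmxBr opprD [RHS]addrACA; congr (_ + _).
    by rewrite opprD addrACA.
  have db s : N (T u1 s - T u2 s) <= gain 0 * mu + gain 0 * mu.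
    by rewrite (le_trans (normB hN _ _))// lerD.
  apply: (forced_bounded_estimate cdv dvm sd db weight_const) => [|k s _].
    by rewrite mulr_ge0// addr_ge0// ltW.
  rewrite mulr1 /dv /v (le_trans (f_lip _ _ _ _ _))// mulrDl.
  have hu' x : N (y x + u1 x - (y x + u2 x)) <= c.
    by rewrite opprD addrACA subrr add0r; have := hu x; rewrite mulr1.
  by rewrite lerD// ler_wpM2l// ltW.
- by move=> t; exact: cst_continuous.
- by rewrite mulr_ge0// ltW.
- move=> t; rewrite subr0 mulr1.
  by have [_] := TP (cst 0) (@cst_continuous _ _ (0 : 'cV[R]_n)); apply.
have [sz bz] := TP z cz; rewrite Tz in sz bz.
exists (fun t => y t + z t); split=> // [|t]; last first.
  by rewrite addrAC subrr add0r -[X in _ / X]subr0.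
apply: cell_solution_add sy sz => k t.
rewrite /nonlin_rhs /forced_rhs /lin_rhs !mulmxDr /v [RHS]addrA; congr (_ + _).
by rewrite addrACA.
Qed.

(** * Differences of two conjugate pairs *)

Section pairs.
Variables (x1 x2 y1 y2 : R -> 'cV[R]_n).
Hypotheses (c1 : conjugate x1 y1) (c2 : conjugate x2 y2).

Let sx1 : nonlin_solution x1. Proof. by case: c1. Qed.
Let sx2 : nonlin_solution x2. Proof. by case: c2. Qed.
Let sy1 : lin_solution y1. Proof. by case: c1. Qed.
Let sy2 : lin_solution y2. Proof. by case: c2. Qed.

Let z t := (x1 t - x2 t) - (y1 t - y2 t).
Let v (k : int) t := f t (x1 t) (x1 (zeta k)) - f t (x2 t) (x2 (zeta k)).

Lemma pair_forcing_continuous k : continuous (v k).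
Proof.
have [cx1 _] := sx1; have [cx2 _] := sx2.
by apply: continuous_sub; exact: f_comp_continuous.
Qed.

Lemma pair_forcing_bounded k t : N (v k t) <= 2 * mu.
Proof. by rewrite (le_trans (normB hN _ _))// mulr_natl mulr2n lerD. Qed.

Lemma pair_solution : cell_solution t_ zeta (forced_rhs A A0 v) z.
Proof.
have sw : cell_solution t_ zeta (forced_rhs A A0 v) (fun t => x1 t - x2 t).
  apply: cell_solution_sub sx1 sx2 => k t.
  rewrite /nonlin_rhs /forced_rhs /lin_rhs !mulmxBr opprD [RHS]addrACA; congr (_ + _).
  by rewrite opprD addrACA.
have sy : lin_solution (fun t => y1 t - y2 t).
  apply: cell_solution_sub sy1 sy2 => k t.
  by rewrite /lin_rhs !mulmxBr opprD addrACA.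
apply: cell_solution_sub sw sy => k t.
rewrite /forced_rhs /lin_rhs !(mulmxBr _ (x1 _ - x2 _)) [RHS]addrAC; congr (_ + _).
by rewrite opprD addrACA.
Qed.

Lemma pair_bounded t :
  N (z t) <= 2 * (2 * K * (rhoA * expR (alpha * theta)) / alpha * mu).
Proof.
have -> : z t = (x1 t - y1 t) - (x2 t - y2 t).
  by rewrite /z !opprD !opprK addrACA.
have [_ _ h1] := c1; have [_ _ h2] := c2.
by rewrite (le_trans (normB hN _ _))// [leRHS]mulr_natl mulr2n lerD.
Qed.

Lemma pair_forcing_lipschitz k s : N (v k s) <=
  l1 * N (x1 s - x2 s) + l2 * N (x1 (zeta k) - x2 (zeta k)).
Proof. exact: f_lip. Qed.

Lemma pair_forcing_split k s : N (v k s) <=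
  l1 * N (z s) + l2 * N (z (zeta k)) +
  (l1 * N (y1 s - y2 s) + l2 * N (y1 (zeta k) - y2 (zeta k))).
Proof.
have h t : N (x1 t - x2 t) <= N (z t) + N (y1 t - y2 t).
  by rewrite (le_trans _ (normD hN _ _))// /z subrK.
rewrite (le_trans (pair_forcing_lipschitz k s))//.
have := ler_wpM2l (ltW l10) (h s); have := ler_wpM2l (ltW l20) (h (zeta k)); lra.
Qed.

End pairs.

(** One d covers both alternatives: [g] is x1 - x2, whose terms alone bound the forcing, or y1 - y2,
    where x1 - x2 = z + (y1 - y2) adds terms in [z]. The first gives the continuity of H, the second
    that of L, and each a uniqueness of partners. *)
Lemma conjugate_pair_close tau e : 0 < e -> exists2 d, 0 < d &
  forall x1 x2 y1 y2, conjugate x1 y1 -> conjugate x2 y2 ->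
    N (x1 tau - x2 tau) < d \/ N (y1 tau - y2 tau) < d ->
    N ((x1 tau - x2 tau) - (y1 tau - y2 tau)) <= e.
Proof.
move=> e0.
have m0 : 0 <= 2 * mu by rewrite mulr_ge0// ltW.
have [d d0 hd] := small_bounded_solution tau
  (2 * (2 * K * (rhoA * expR (alpha * theta)) / alpha * mu)) e0 m0.
exists d => // x1 x2 y1 y2 c1 c2.
have cv := pair_forcing_continuous c1 c2.
have hv := @pair_forcing_bounded x1 x2.
have sz := pair_solution c1 c2; have bz := pair_bounded c1 c2.
have [sx1 sy1 _] := c1; have [sx2 sy2 _] := c2.
have step := hd _ _ _ cv hv sz bz.
case=> [xd|yd].
- apply: (step _ (difference_inequality_sub admissible_nonlin sx1 sx2) _ xd) => k s _.
  by rewrite (le_trans (pair_forcing_lipschitz x1 x2 k s))// lerDr addr_ge0//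
    mulr_ge0 ?norm_ge0// ltW.
- have al := admissible_lin hN cA cA0 Aa A0b.
  apply: (step _ (difference_inequality_sub al sy1 sy2) _ yd) => k s _.
  exact: pair_forcing_split.
Qed.

Lemma conjugate_injl x y1 y2 : conjugate x y1 -> conjugate x y2 -> y1 = y2.
Proof.
move=> c1 c2; apply/funext => t; apply/eqP; rewrite eq_sym -subr_eq0; apply/eqP.
apply: (norm_eq0 hN); apply/eqP; rewrite eq_le norm_ge0// andbT leNgt; apply/negP.
set D := N _ => D0.
have D20 : 0 < D / 2 by rewrite divr_gt0.
have [d d0 /(_ _ _ _ _ c1 c2)] := conjugate_pair_close t D20.
rewrite !subrr norm0// sub0r opprB => /(_ (or_introl d0)); rewrite -/D; lra.
Qed.

Lemma conjugate_injr x1 x2 y : conjugate x1 y -> conjugate x2 y -> x1 = x2.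
Proof.
move=> c1 c2; apply/funext => t; apply/eqP; rewrite -subr_eq0; apply/eqP.
apply: (norm_eq0 hN); apply/eqP; rewrite eq_le norm_ge0// andbT leNgt; apply/negP.
set D := N _ => D0.
have D20 : 0 < D / 2 by rewrite divr_gt0.
have [d d0 /(_ _ _ _ _ c1 c2)] := conjugate_pair_close t D20.
rewrite !subrr norm0// subr0 => /(_ (or_intror d0)); rewrite -/D; lra.
Qed.

Lemma unif_continuous_norm (h : 'cV[R]_n -> 'cV[R]_n) :
  (forall e, 0 < e -> exists2 d, 0 < d &
    forall u1 u2, N (u1 - u2) < d -> N (h u1 - h u2) < e) ->
  unif_continuous h.
Proof.
move=> hyp; apply/unif_continuousP => e e0.
have [c c0 hc] := norm_ge_sup hN; have [C C0 hC] := norm_le_sup hN.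
have [d d0 hd] := hyp (e / c) (divr_gt0 e0 c0).
exists (d / C); first exact: divr_gt0.
move=> [u1 u2]; rewrite -!ball_normE/= => u12.
rewrite (le_lt_trans (hc _))// mulrC -ltr_pdivlMr//; apply: hd.
by rewrite (le_lt_trans (hC _))// mulrC -ltr_pdivlMr.
Qed.

Lemma unif_continuous_continuous (U W : normedModType R) (h : U -> W) :
  unif_continuous h -> continuous h.
Proof.
move=> /unif_continuousP hu x; apply/cvgrPdist_lt => e e0.
have [d d0 hd] := hu e e0.
apply/nbhs_ballP; exists d => //= y xy.
by have := hd (x, y) xy; rewrite -ball_normE.
Qed.

Lemma conjugate_through_nonlin tau xi :
  exists p : (R -> 'cV[R]_n) * (R -> 'cV[R]_n), conjugate p.1 p.2 /\ p.1 tau = xi.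
Proof.
have [x sx xt] := cell_solution_exists hN hseq a0 b0 theta0 smallness tau xi
  admissible_nonlin.
by have [y c] := lin_partner_exists sx; exists (x, y).
Qed.

Lemma conjugate_through_lin tau xi :
  exists p : (R -> 'cV[R]_n) * (R -> 'cV[R]_n), conjugate p.1 p.2 /\ p.2 tau = xi.
Proof.
have [y sy yt] := cell_solution_exists hN hseq a0 b0 theta0 smallness tau xi
  (admissible_lin hN cA cA0 Aa A0b).
by have [x c] := nonlin_partner_exists sy; exists (x, y).
Qed.

Theorem cell_solutions_strongly_equivalent :
  strongly_top_equivalent N [set y | lin_solution y] [set x | nonlin_solution x].
Proof.
(* The pair is chosen anew at each [tau] and [xi]; [HE] and [LE] show that the value depends only on
   the solution through that point. *)
pose H tau xi := (projT1 (cid (conjugate_through_nonlin tau xi))).2 tau.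
pose L tau xi := (projT1 (cid (conjugate_through_lin tau xi))).1 tau.
have HE x y tau : conjugate x y -> H tau (x tau) = y tau.
  move=> c; rewrite /H; case: cid => -[x' y'] /= [c' e].
  have [sx _ _] := c; have [sx' _ _] := c'.
  have xx : x' = x.
    exact: (cell_solution_uniq hN hseq a0 b0 theta0 smallness admissible_nonlin sx' sx e).
  by rewrite xx in c'; rewrite (conjugate_injl c' c).
have LE x y tau : conjugate x y -> L tau (y tau) = x tau.
  move=> c; rewrite /L; case: cid => -[x' y'] /= [c' e].
  have [_ sy _] := c; have [_ sy' _] := c'.
  have yy : y' = y by apply/funext => t; rewrite (Z_uniq tau t sy') (Z_uniq tau t sy) e.
  by rewrite yy in c'; rewrite (conjugate_injr c' c).
have HK tau : cancel (H tau) (L tau).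
  move=> xi; have [[x y] /= [c <-]] := conjugate_through_nonlin tau xi.
  by rewrite (HE x y)// (LE x y).
have LK tau : cancel (L tau) (H tau).
  move=> xi; have [[x y] /= [c <-]] := conjugate_through_lin tau xi.
  by rewrite (LE x y)// (HE x y).
have Hu tau : unif_continuous (H tau).
  apply: unif_continuous_norm => e e0.
  have e2 : 0 < e / 2 by rewrite divr_gt0.
  have [d d0 hd] := conjugate_pair_close tau e2.
  (* y1 - y2 differs from x1 - x2 by at most e / 2 at [tau], and x1 - x2 is itself below e / 2. *)
  exists (Num.min d (e / 2)) => [|xi1 xi2]; first by rewrite lt_min d0.
  have [[x1 y1] /= [c1 <-]] := conjugate_through_nonlin tau xi1.
  have [[x2 y2] /= [c2 <-]] := conjugate_through_nonlin tau xi2.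
  rewrite lt_min (HE _ _ tau c1) (HE _ _ tau c2) => /andP[h1 h2].
  have := hd _ _ _ _ c1 c2 (or_introl h1).
  have := norm_sub hN (y1 tau - y2 tau) (x1 tau - x2 tau).
  by rewrite (norm_distC hN (y1 tau - y2 tau)); lra.
have Lu tau : unif_continuous (L tau).
  apply: unif_continuous_norm => e e0.
  have e2 : 0 < e / 2 by rewrite divr_gt0.
  have [d d0 hd] := conjugate_pair_close tau e2.
  exists (Num.min d (e / 2)) => [|xi1 xi2]; first by rewrite lt_min d0.
  have [[x1 y1] /= [c1 <-]] := conjugate_through_lin tau xi1.
  have [[x2 y2] /= [c2 <-]] := conjugate_through_lin tau xi2.
  rewrite lt_min (LE _ _ tau c1) (LE _ _ tau c2) => /andP[h1 h2].
  have := hd _ _ _ _ c1 c2 (or_intror h1).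
  have := norm_sub hN (x1 tau - x2 tau) (y1 tau - y2 tau); lra.
exists H, L; split=> [tau|||tau]; [by split| | |by split].
- split=> [tau||x sx].
  + split; first exact: unif_continuous_continuous.
    by exists (L tau); split=> //; exact: unif_continuous_continuous.
  + exists (2 * K * (rhoA * expR (alpha * theta)) / alpha * mu) => tau xi.
    have [[x y] /= [c <-]] := conjugate_through_nonlin tau xi.
    by rewrite (HE x y)// norm_distC//; case: c.
  + have [y c] := lin_partner_exists sx.
    have -> : (fun t => H t (x t)) = y by apply/funext => t; exact: HE.
    by case: c.
- split=> [tau||y sy].
  + split; first exact: unif_continuous_continuous.
    by exists (H tau); split=> //; exact: unif_continuous_continuous.
  + exists (2 * K * (rhoA * expR (alpha * theta)) / alpha * mu) => tau xi.
    have [[x y] /= [c <-]] := conjugate_through_lin tau xi.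
    by rewrite (LE x y)//; case: c.
  + have [x c] := nonlin_partner_exists sy.
    have -> : (fun t => L t (y t)) = x by apply/funext => t; exact: LE.
    by case: c.
Qed.

End conjugacy.

Theorem theorem2 (R : realType) (n : nat) (N : 'cV[R]_n -> R)
  (A A0 : R -> 'M[R]_n) (f : R -> 'cV[R]_n -> 'cV[R]_n -> 'cV[R]_n)
  (M M0 mu l1 l2 : R)
  (t_ zeta : int -> R) (theta : R) (gamma : R -> R)
  (nu_plus nu_minus : R) (P : 'M[R]_n) (K alpha : R) :
  is_norm N ->
  continuous A -> continuous A0 ->
  continuous (fun p : R * 'cV[R]_n * 'cV[R]_n => f p.1.1 p.1.2 p.2) ->
  0 < M -> 0 < M0 -> 0 < mu -> 0 < l1 -> 0 < l2 ->
  (forall t, opnorm N (A t) <= M) ->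
  (forall t, opnorm N (A0 t) <= M0) ->
  (forall t x y, N (f t x y) <= mu) ->
  (forall t x x' y y',
     N (f t x y - f t x' y') <= l1 * N (x - x') + l2 * N (y - y')) ->
  0 < theta -> pca_seqs t_ zeta theta -> pca_arg t_ zeta gamma ->
  0 < nu_plus -> 0 < nu_minus ->
  sup (range (fun k =>
    rho_plus N t_ zeta A k * ln (rho_plus N t_ zeta A0 k))) <= nu_plus ->
  nu_plus < 1 ->
  sup (range (fun k =>
    rho_minus N t_ zeta A k * ln (rho_minus N t_ zeta A0 k))) <= nu_minus ->
  nu_minus < 1 ->
  let Z := transition t_ gamma A A0 in
  exp_dichotomy N Z P K alpha ->
  (forall k : int,
     [/\ abs_convergent N [set r | r <= k] (series_plus t_ zeta A Z P),
         abs_convergent N [set r | r <= k] (series_minus t_ zeta A Z P),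
         abs_convergent N [set r | k <= r]
           (series_plus t_ zeta A Z (1%:M - P))
       & abs_convergent N [set r | k <= r]
           (series_minus t_ zeta A Z (1%:M - P))]) ->
  let rho_star := rho N t_ zeta A * expR (alpha * theta) in
  2 * (l1 + l2) * K * rho_star < alpha ->
  (expR ((M + l1) * theta) - 1) / ((M + l1) * theta) * (M0 + l2) * theta < 1 ->
  (expR (M * theta) - 1) / (M * theta) * M0 * theta < 1 ->
  strongly_top_equivalent N
    [set y | is_solution t_ gamma (lin_rhs A A0) y]
    [set x | is_solution t_ gamma (nonlin_rhs A A0 f) x].
Proof.
move=> hN cA cA0 cf M_gt0 M0_gt0 mu0 l10 l20 AM A0M0 f_mu f_lip theta0 hseq hgamma
  _ _ _ _ _ _ Z dich _ rho_star gain_lt small _.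
(* Lipschitz constants of the perturbed equation, valid also for the linear one. With them the
   condition on F_1 is exactly [smallness]. *)
pose a := M + l1; pose b := M0 + l2.
have a0 : 0 < a by rewrite addr_gt0.
have b0 : 0 < b by rewrite addr_gt0.
have Aa t : opnorm N (A t) <= a by rewrite (le_trans (AM t))// lerDl ltW.
have A0b t : opnorm N (A0 t) <= b by rewrite (le_trans (A0M0 t))// lerDl ltW.
have smallness : b * ((expR (a * theta) - 1) / a) < 1.
  apply: le_lt_trans small; rewrite -/a -/b le_eqVlt; apply/orP; left; apply/eqP.
  by field; rewrite !lt0r_neq0.
have adm : admissible N a b (fun=> nonlin_rhs A A0 f).
  split=> [k u y cu|k t x x' y y'|].
  - apply: continuous_add; first exact: lin_rhs_continuous.
    exact: f_comp_continuous.
  - rewrite /nonlin_rhs opprD addrACA (le_trans (normD hN _ _))//.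
    have h1 := lin_rhs_lipschitz hN AM A0M0 t x x' y y'.
    have h2 := f_lip t x x' y y'; rewrite /lin_rhs in h1.
    rewrite /a /b; lra.
  - by exists mu => k t; rewrite /nonlin_rhs !mulmx0 !add0r.
have adml := admissible_lin hN cA cA0 Aa A0b.
have -> : [set y | is_solution t_ gamma (lin_rhs A A0) y] =
    [set y | cell_solution t_ zeta (fun=> lin_rhs A A0) y].
  apply/seteqP; split=> y /=;
    by move/(is_solutionP hN hseq a0 b0 theta0 smallness hgamma y adml).
have -> : [set x | is_solution t_ gamma (nonlin_rhs A A0 f) x] =
    [set x | cell_solution t_ zeta (fun=> nonlin_rhs A A0 f) x].
  apply/seteqP; split=> y /=;
    by move/(is_solutionP hN hseq a0 b0 theta0 smallness hgamma y adm).
exact: (cell_solutions_strongly_equivalent hN hseq a0 b0 theta0 smallness cA cA0 Aa A0b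
  (transition_solution hN hseq hgamma a0 b0 theta0 smallness cA cA0 Aa A0b)
  (transition_id hN hseq hgamma a0 b0 theta0 smallness cA cA0 Aa A0b)
  (transition_uniq hN hseq hgamma a0 b0 theta0 smallness cA cA0 Aa A0b)
  dich cf mu0 l10 l20 f_mu f_lip adm gain_lt).
Qed.
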